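(* Assume that for every numerical semigroup $S$ with $n(S)=13$ the following four implications hold: (i) if $e\le3$ then $c\le13e$; (ii) if $q\le3$ then $c\le13e$; (iii) if $e\ge4$ and $q=4$ then $c\le13e$; (iv) if $e\ge4$ and $q\ge5$ then $c\le13e$. Then: (a) Every $T\in\mathbb P_\square$ has a refinement $T^*\le T$ with the same stem such that every $g\in[T^*]$ is accepted at every stage beyond the stem, i.e. $g(n)\in C_n$ for all $n\ge|\operatorname{stem}(T)|$. In particular $\{T\in\mathbb P_\square:[T]\subseteq X_{\mathrm{acc}}\}$ is dense in $\mathbb P_\square$. (b) There is a computable pure-quadrant tree whose body is contained in $X_{\mathrm{acc}}$, and Selector has a computable winning strategy in $G_s(X_{\mathrm{acc}})$ from every finite stem $s$. (c) For each code $u\in\mathbb N$, the set $D_u$ of conditions whose stems include an accepted $u$-cell (i.e. there is $n<|\operatorname{stem}(T)|$ with $u_n=u$ and $\operatorname{stem}(T)(n)\in C_n$) is open dense. Thus every generic branch reads a sound certificate of $R_{13}(u)$ for every code $u$, and $$1_{\mathbb P_\square}\Vdash\forall S\,\bigl(S\text{ a numerical semigroup}\ \wedge\ n(S)=13\ \Rightarrow\ c(S)\le13e(S)\bigr).$$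
   Context: Numerical semigroups. A numerical semigroup is a cofinite additive submonoid $S\subseteq\mathbb N$. Its multiplicity $m$ is its least positive element; its conductor $c$ is the least $c\ge 0$ with $c+\mathbb N\subseteq S$; $n=|S\cap[0,c)|$; $e$ is the number of primitive elements (positive elements of $S$ that are not sums of two positive elements of $S$); $q=\lceil c/m\rceil$. Codes. For $u\in\mathbb N$ let $F_u=\{x:\text{the }x\text{-th binary digit of }u\text{ is }1\}$ and $S_u=\mathbb N\setminus F_u$. $\operatorname{NS}(u)$ says that $S_u$ is a numerical semigroup (this is decidable), and for such $u$ the values $c(u),n(u),e(u),q(u),m(u)$ are the invariants of $S_u$; for invalid codes they are $0$. All are computable. $R_{13}(u)$ is the statement $\neg(\operatorname{NS}(u)\wedge n(u)=13)\ \vee\ c(u)\le13e(u)$. Fix a computable pairing bijection $\langle\cdot,\cdot\rangle:\mathbb N^2\to\mathbb N$ and the schedule $u_{\langle u,t\rangle}=u$, so each code recurs infinitely often. Certificates. For each code $u$ and parity $p\in\{0,1\}$ there is a requested certificate. If $\operatorname{NS}(u)$ and $n(u)=13$: for $p=0$ it is the checked finite arithmetic trace (bounded membership and primitive tables with their counts) of $u$ together with the global derivation of $c\le13e$, which joins all four implications (i)–(iv) by the exhaustive case split; for $p=1$ it is the trace together with the local derivation of $c\le 13e$ from the single implication whose hypothesis is the first true one in the order (i)–(iv). If not ($\operatorname{NS}(u)$ and $n(u)=13$), either parity requests a finite certificate of that fact. A fixed computable producer, given $(u,p)$, computes the requested certificate, and a fixed computable verifier checks the finite calculations and the hypotheses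 of the fixed proof template. For each fixed $u$ and $p$: if $R_{13}(u)$ holds, producer and verifier terminate with an accepted certificate; if $R_{13}(u)$ fails, no certificate is accepted (verifier soundness). At stage $n$, the cell $(i,j)\in\omega^2$ has parity $p=|i-j|\bmod2$; it is accepted iff the producer on $(u_n,p)$ halts within $i$ steps and the verifier then accepts its output within a fresh budget of $j$ steps. $C_n\subseteq\omega^2$ is the set of accepted cells at stage $n$, and $$X_{\mathrm{acc}}=\bigcap_{u\in\mathbb N}\ \bigcup_{n:u_n=u}\{g\in(\omega^2)^\omega:g(n)\in C_n\}.$$ Forcing and game. $E_N=[N,\infty)^2\subseteq\omega^2$. $\mathbb P_\square$ is the set of nonempty trees $T\subseteq(\omega^2)^{<\omega}$, closed under initial segments, with a stem (the longest node common to all branches, below which the tree has one path) such that for every $t\in T$ with $t\supseteq\operatorname{stem}(T)$ the successor set $\{a:t^\frown a\in T\}$ contains some $E_N$; the order is inclusion (smaller is stronger), with largest condition $1_{\mathbb P_\square}=(\omega^2)^{<\omega}$. $[T]$ is the set of infinite branches of $T$. A pure-quadrant tree is one in which every node at or above the stem has successor set exactly some $E_{N}$ (with $N$ depending on the node). A generic branch is the union of the stems of the trees in a generic filter over the transitive ground model $V$. In $G_s(X)$, at round $r$ Builder announces $N_r<\omega$ and Selector answers $a_r\in E_{N_r}$; Selector wins iff $s^\frown(a_r)_{r<\omega}\in X$. ''Open dense'' means dense and closed under strengthening. *)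

(* Defs.v *)
From HB Require Import structures.
From mathcomp Require Import finmap all_boot.
From mathcomp Require Import boolp classical_sets functions cardinality.

Set Implicit Arguments.
Unset Strict Implicit.
Unset Printing Implicit Defensive.

Local Open Scope classical_set_scope.

Definition numerical_semigroup (S : set nat) : Prop :=
  [/\ S 0, (forall x y, S x -> S y -> S (x + y)) & finite_set (~` S)].

(* The least element of [A] (0 if [A] is empty). *)
Definition least (A : set nat) : nat :=
  xget 0 [set x | A x /\ forall y, A y -> x <= y].

Definition multiplicity (S : set nat) : nat := least [set x | S x /\ 0 < x].

Definition conductor (S : set nat) : nat :=
  least [set c | forall x, c <= x -> S x].

Definition left_count (S : set nat) : nat :=
  #|` fset_set (S `&` `I_(conductor S))|%fset.

Definition primitive (S : set nat) : set nat :=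
  [set x | [/\ S x, 0 < x &
     ~ exists a b, [/\ S a /\ 0 < a, S b /\ 0 < b & x = a + b]]].

Definition embedding_dim (S : set nat) : nat := #|` fset_set (primitive S)|%fset.

(* The ceiling of [conductor S / multiplicity S]. *)
Definition depth (S : set nat) : nat :=
  (conductor S + (multiplicity S).-1) %/ multiplicity S.

Definition gaps_of (u : nat) : set nat := [set x | odd (u %/ 2 ^ x)].

Definition sgp (u : nat) : set nat := ~` gaps_of u.

Definition NS (u : nat) : Prop := numerical_semigroup (sgp u).

Definition code_value (inv : set nat -> nat) (u : nat) : nat :=
  if `[< NS u >] then inv (sgp u) else 0.

Definition c_ := code_value conductor.
Definition n_ := code_value left_count.
Definition e_ := code_value embedding_dim.
Definition q_ := code_value depth.
Definition m_ := code_value multiplicity.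

Definition R13 (u : nat) : Prop := ~ (NS u /\ n_ u = 13) \/ c_ u <= 13 * e_ u.

(* Programs for partial recursive functions of several variables: [Proj i]
   returns the [i]-th argument, [Rec f g] is primitive recursion on the first
   argument and [Mu f] is minimisation over the first argument of [f]. *)
Inductive prog : Type :=
| Zero
| Succ
| Proj of nat
| Comp of prog & seq prog
| Rec of prog & prog
| Mu of prog.

(* [runs p xs z t]: on the arguments [xs] the program [p] halts with output [z]
   after [t] steps. *)
Inductive runs : prog -> seq nat -> nat -> nat -> Prop :=
| runs_zero xs : runs Zero xs 0 1
| runs_succ x xs : runs Succ (x :: xs) x.+1 1
| runs_proj i xs : runs (Proj i) xs (nth 0 xs i) 1
| runs_comp f gs xs ys z s t :
    runs_all gs xs ys s -> runs f ys z t -> runs (Comp f gs) xs z (s + t).+1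
| runs_rec0 f g xs z t : runs f xs z t -> runs (Rec f g) (0 :: xs) z t.+1
| runs_recS f g k xs y z s t :
    runs (Rec f g) (k :: xs) y s -> runs g (k :: y :: xs) z t ->
    runs (Rec f g) (k.+1 :: xs) z (s + t).+1
| runs_mu f xs z t : searches f xs 0 z t -> runs (Mu f) xs z t.+1
with runs_all : seq prog -> seq nat -> seq nat -> nat -> Prop :=
| runs_nil xs : runs_all [::] xs [::] 0
| runs_cons g gs xs y ys s t :
    runs g xs y s -> runs_all gs xs ys t ->
    runs_all (g :: gs) xs (y :: ys) (s + t)
(* [searches f xs k z t]: testing [k], [k + 1], ... in turn, the first zero of
   [f] is found at [z]. *)
with searches : prog -> seq nat -> nat -> nat -> nat -> Prop :=
| searches_stop f xs k t : runs f (k :: xs) 0 t -> searches f xs k k t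
| searches_next f xs k y z s t :
    runs f (k :: xs) y.+1 s -> searches f xs k.+1 z t ->
    searches f xs k z (s + t).

Definition halts_within (k : nat) (p : prog) (xs : seq nat) (z : nat) : Prop :=
  exists2 t, t <= k & runs p xs z t.

Definition outputs (p : prog) (xs : seq nat) (z : nat) : Prop :=
  exists t, runs p xs z t.

(* Total computability; [pickle] is the coding by natural numbers.  It is used
   only for types built from [nat] and [bool] by pairs and sequences, where it
   is an effective coding. *)
Definition computable (A B : countType) (f : A -> B) : Prop :=
  exists p, forall x, outputs p [:: pickle x] (pickle (f x)).

(* The membership and primitive tables list the truth values at
   [0, ..., c + m - 1]; every primitive element lies below [c + m]. *)
Record trace := Trace {
  tr_mem : seq bool;
  tr_prim : seq bool;
  tr_m : nat;
  tr_c : nat;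
  tr_n : nat;
  tr_e : nat;
  tr_q : nat }.

Definition trace_code (t : trace) :=
  (tr_mem t, tr_prim t, (tr_m t, tr_c t, tr_n t, tr_e t, tr_q t)).
Definition trace_decode (x : seq bool * seq bool * (nat * nat * nat * nat * nat)) :=
  let: (a, b, (m, c, n, e, q)) := x in Trace a b m c n e q.
Lemma trace_codeK : cancel trace_code trace_decode. Proof. by case. Qed.
HB.instance Definition _ := Countable.copy trace (can_type trace_codeK).

Definition trace_of (u : nat) : trace :=
  let bound := c_ u + m_ u in
  let mem := [seq `[< sgp u x >] | x <- iota 0 bound] in
  let prim := [seq `[< primitive (sgp u) x >] | x <- iota 0 bound] in
  Trace mem prim (m_ u) (c_ u) (count id (take (c_ u) mem)) (count id prim) (q_ u).

(* The four implications all conclude [c <= 13 * e]; these are their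
   hypotheses. *)
Definition hypothesis (e q : nat) (k : 'I_4) : bool :=
  nth false [:: e <= 3; q <= 3; (4 <= e) && (q == 4); (4 <= e) && (5 <= q)] k.

(* A derivation of [c <= 13 * e] is the list of the implications joined by a case
   split on their hypotheses: all four of them for the global derivation, and
   for the local one only the first whose hypothesis is true. *)
Definition requested_derivation (p : bool) (e q : nat) : seq 'I_4 :=
  if p then take 1 [seq k <- enum 'I_4 | hypothesis e q k] else enum 'I_4.

Inductive certificate :=
| Derivation of trace & seq 'I_4
| ZeroMissing
| SumMissing of nat & nat
| OtherCount of trace.

Definition certificate_code (d : certificate) :
    (trace * seq 'I_4) + (unit + (nat * nat + trace)) :=
  match d with
  | Derivation t ks => inl (t, ks)
  | ZeroMissing => inr (inl tt)
  | SumMissing a b => inr (inr (inl (a, b)))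
  | OtherCount t => inr (inr (inr t))
  end.
Definition certificate_decode
    (x : (trace * seq 'I_4) + (unit + (nat * nat + trace))) : certificate :=
  match x with
  | inl (t, ks) => Derivation t ks
  | inr (inl _) => ZeroMissing
  | inr (inr (inl (a, b))) => SumMissing a b
  | inr (inr (inr t)) => OtherCount t
  end.
Lemma certificate_codeK : cancel certificate_code certificate_decode.
Proof. by case. Qed.
HB.instance Definition _ :=
  Countable.copy certificate (can_type certificate_codeK).

Definition requested (u : nat) (p : bool) (d : certificate) : Prop :=
  match d with
  | Derivation t ks =>
      [/\ NS u /\ n_ u = 13, t = trace_of u
        & ks = requested_derivation p (e_ u) (q_ u)]
  | ZeroMissing => ~ sgp u 0
  | SumMissing a b => [/\ sgp u a, sgp u b & ~ sgp u (a + b)]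
  | OtherCount t => [/\ NS u, t = trace_of u & n_ u <> 13]
  end.

(* The specification of the fixed producer and verifier; the verifier accepts by
   returning 1. *)
Record certification (producer verifier : prog) : Prop := {
  producer_requested : forall u (p : bool) z,
    outputs producer [:: u; nat_of_bool p] z ->
    exists2 d, requested u p d & z = pickle d;
  verifier_checks : forall u (p : bool) z,
    outputs verifier [:: u; nat_of_bool p; z] 1 ->
    exists2 d, requested u p d & z = pickle d;
  certification_complete : forall u (p : bool), R13 u ->
    exists2 z, outputs producer [:: u; nat_of_bool p] z
             & outputs verifier [:: u; nat_of_bool p; z] 1;
  certification_sound : forall u, ~ R13 u ->
    forall (p : bool) z, ~ outputs verifier [:: u; nat_of_bool p; z] 1 }.

Definition cell : Type := (nat * nat)%type.

(* [|i - j|] mod 2; one of the two truncated differences is zero. *)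
Definition parity (a : cell) : bool := odd ((a.1 - a.2) + (a.2 - a.1)).

Definition reads (producer verifier : prog) (u : nat) (a : cell) (z : nat) : Prop :=
  halts_within a.1 producer [:: u; nat_of_bool (parity a)] z /\
  halts_within a.2 verifier [:: u; nat_of_bool (parity a); z] 1.

Definition accepted (producer verifier : prog) (sched : nat -> nat) (n : nat)
    : set cell :=
  [set a | exists z, reads producer verifier (sched n) a z].

Definition X_acc (producer verifier : prog) (sched : nat -> nat)
    : set (nat -> cell) :=
  \bigcap_(u in [set: nat]) \bigcup_(n in [set n | sched n = u])
    [set g | accepted producer verifier sched n (g n)].

(* The cell [a], read at stage [n], shows a sound certificate of [R13 u]. *)
Definition sound_reading (producer verifier : prog) (sched : nat -> nat)
    (u n : nat) (a : cell) : Prop :=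
  sched n = u /\
  exists d : certificate,
    [/\ reads producer verifier u a (pickle d), requested u (parity a) d & R13 u].

Definition quadrant (N : nat) : set cell := [set a | N <= a.1 /\ N <= a.2].

Definition body (T : set (seq cell)) : set (nat -> cell) :=
  [set g | forall n, T (mkseq g n)].

Definition on_all_branches (T : set (seq cell)) (s : seq cell) : Prop :=
  forall g, body T g -> s = mkseq g (size s).

Definition is_stem (T : set (seq cell)) (s : seq cell) : Prop :=
  [/\ T s, on_all_branches T s,
      (forall t, T t -> on_all_branches T t -> size t <= size s) &
      (forall t, T t -> prefix t s || prefix s t)].

Record condition := Condition {
  nodes : set (seq cell);
  stem : seq cell;
  nodes_closed : forall s t, prefix s t -> nodes t -> nodes s;
  stemP : is_stem nodes stem;
  nodes_large : forall t, nodes t -> prefix stem t ->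
    exists N, quadrant N `<=` [set a | nodes (rcons t a)] }.

Definition stronger (T' T : condition) : Prop := nodes T' `<=` nodes T.

Definition dense (D : set condition) : Prop :=
  forall T, exists2 T', stronger T' T & D T'.

Definition open_dense (D : set condition) : Prop :=
  dense D /\ forall T T', D T -> stronger T' T -> D T'.

Definition pure_quadrant (T : condition) : Prop :=
  forall t, nodes T t -> prefix (stem T) t ->
    exists N, [set a | nodes T (rcons t a)] = quadrant N.

Lemma full_stem : is_stem [set: seq cell] [::].
Proof.
split=> // [t _ h|t _]; last by rewrite prefix0s orbT.
have := h (fun=> (0, 0)) (fun=> I); have := h (fun=> (1, 1)) (fun=> I).
by case: t {h} => //= a t [-> _] [].
Qed.

Definition full_condition : condition :=
  @Condition [set: seq cell] [::] (fun _ _ _ _ => I) full_stem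
    (fun _ _ _ => ex_intro _ 0 (fun _ _ => I)).

Definition decides_code (producer verifier : prog) (sched : nat -> nat) (u : nat)
    : set condition :=
  [set T | exists n, [/\ n < size (stem T), sched n = u &
     accepted producer verifier sched n (nth (0, 0) (stem T) n)]].

Definition prepend (s : seq cell) (a : nat -> cell) : nat -> cell :=
  fun n => if n < size s then nth (0, 0) s n else a (n - size s).

(* A strategy sends the previous rounds [(N_k, a_k)], [k < r], and the current
   announcement [N_r] to the answer [a_r]. *)
Definition strategy : Type := seq (nat * cell) -> nat -> cell.

Definition winning (s : seq cell) (X : set (nat -> cell)) (f : strategy) : Prop :=
  forall (N : nat -> nat) (a : nat -> cell),
    (forall r, a r = f (mkseq (fun k => (N k, a k)) r) (N r)) ->
    (forall r, quadrant (N r) (a r)) /\ X (prepend s a).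

Section Forcing.
Variables (P : Type) (le : P -> P -> Prop) (one : P).

(* [P]-names: [Name I x c] is the set of pairs [(x i, c i)]. *)
Inductive name : Type := Name (I : Type) of I -> name & I -> P.

(* Formulas of the forcing language, with names as parameters. *)
Inductive formula : Type :=
| FEq of name & name
| FMem of name & name
| FFalse
| FAnd of formula & formula
| FOr of formula & formula
| FImp of formula & formula
| FAll of (name -> formula)
| FEx of (name -> formula).

Definition dense_below (p : P) (D : P -> Prop) : Prop :=
  forall q, le q p -> exists2 r, le r q & D r.

(* [forces_eq x y p] is "p forces x = y", by recursion on names as usual; the
   clauses of [forces] below give a relation closed under strengthening, and a
   formula forced densely below [p] is forced by [p]. *)
Fixpoint forces_eq (x y : name) (p : P) {struct x} : Prop :=
  match x, y with
  | Name K xs c, Name J ys d =>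
      (forall i q, le q p -> le q (c i) ->
         exists2 r, le r q & exists2 j, le r (d j) & forces_eq (xs i) (ys j) r) /\
      (forall j q, le q p -> le q (d j) ->
         exists2 r, le r q & exists2 i, le r (c i) & forces_eq (xs i) (ys j) r)
  end.

Definition forces_mem (x y : name) (p : P) : Prop :=
  let: Name J ys d := y in
  dense_below p (fun r => exists2 j, le r (d j) & forces_eq x (ys j) r).

Fixpoint forces (p : P) (A : formula) : Prop :=
  match A with
  | FEq x y => forces_eq x y p
  | FMem x y => forces_mem x y p
  | FFalse => False
  | FAnd A B => forces p A /\ forces p B
  | FOr A B => dense_below p (fun r => forces r A \/ forces r B)
  | FImp A B => forall q, le q p -> forces q A -> forces q B
  | FAll F => forall x, forces p (F x)
  | FEx F => dense_below p (fun r => exists x, forces r (F x))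
  end.

Definition FNot (A : formula) := FImp A FFalse.
Definition FIff (A B : formula) := FAnd (FImp A B) (FImp B A).
Definition FAllIn (y : name) (F : name -> formula) :=
  FAll (fun x => FImp (FMem x y) (F x)).
Definition FExIn (y : name) (F : name -> formula) :=
  FEx (fun x => FAnd (FMem x y) (F x)).

(* Names of ground-model sets: von Neumann naturals, Kuratowski pairs. *)
Definition ground (I : Type) (x : I -> name) : name := Name x (fun=> one).

Definition adjoin (x y : name) : name :=
  let: Name K xs c := x in
  Name (fun o : option K => oapp xs y o) (fun o => oapp c one o).

Fixpoint numeral (n : nat) : name :=
  if n is k.+1 then adjoin (numeral k) (numeral k)
  else ground (fun v : void => match v with end).

Definition upair (x y : name) : name := ground (fun b : bool => if b then x else y).
Definition opair (x y : name) : name := upair (upair x x) (upair x y).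
Definition triple (x y z : name) : name := opair x (opair y z).

Definition omega : name := ground numeral.
Definition add_graph : name := ground (fun x : nat * nat =>
  triple (numeral x.1) (numeral x.2) (numeral (x.1 + x.2))).
Definition mul_graph : name := ground (fun x : nat * nat =>
  triple (numeral x.1) (numeral x.2) (numeral (x.1 * x.2))).

Definition f_upair (p x y : name) :=
  FAll (fun z => FIff (FMem z p) (FOr (FEq z x) (FEq z y))).
Definition f_pair (p x y : name) :=
  FEx (fun a => FEx (fun b =>
    FAnd (f_upair a x x) (FAnd (f_upair b x y) (f_upair p a b)))).
Definition f_related (x y f : name) := FExIn f (fun p => f_pair p x y).
Definition f_related3 (x y z f : name) :=
  FExIn f (fun p => FEx (fun w => FAnd (f_pair w y z) (f_pair p x w))).

(* [f] restricts to a bijection from [k] to the class [A]. *)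
Definition f_bijection (f k : name) (A : name -> formula) :=
  FAnd (FAllIn k (fun i => FEx (fun x => FAnd (A x) (f_related i x f))))
 (FAnd (FAll (fun x => FImp (A x) (FExIn k (fun i => f_related i x f))))
 (FAnd (FAllIn k (fun i => FAll (fun x => FAll (fun y => FImp (f_related i x f)
          (FImp (f_related i y f) (FEq x y))))))
       (FAllIn k (fun i => FAllIn k (fun j => FAll (fun x => FImp (f_related i x f)
          (FImp (f_related j x f) (FEq i j)))))))).
Definition f_card (k : name) (A : name -> formula) :=
  FAnd (FMem k omega) (FEx (fun f => f_bijection f k A)).

Definition f_le (x y : name) := FOr (FMem x y) (FEq x y).
Definition f_pos (x : name) := FNot (FEq x (numeral 0)).

Definition f_semigroup (S : name) :=
  FAnd (FAllIn S (fun x => FMem x omega))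
 (FAnd (FMem (numeral 0) S)
 (FAnd (FAllIn S (fun a => FAllIn S (fun b => FAll (fun c =>
          FImp (f_related3 a b c add_graph) (FMem c S)))))
       (FEx (fun k =>
          f_card k (fun x => FAnd (FMem x omega) (FNot (FMem x S))))))).

Definition f_tail (S c : name) :=
  FAllIn omega (fun x => FImp (f_le c x) (FMem x S)).
Definition f_conductor (S c : name) :=
  FAnd (FMem c omega) (FAnd (f_tail S c)
    (FAllIn omega (fun d => FImp (f_tail S d) (f_le c d)))).

Definition f_left_count (S n : name) :=
  FEx (fun c => FAnd (f_conductor S c)
    (f_card n (fun x => FAnd (FMem x S) (FMem x c)))).

Definition f_primitive (S x : name) :=
  FAnd (FMem x S) (FAnd (f_pos x)
    (FNot (FExIn S (fun a => FExIn S (fun b =>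
       FAnd (f_pos a) (FAnd (f_pos b) (f_related3 a b x add_graph))))))).
Definition f_embedding_dim (S e : name) := f_card e (f_primitive S).

Definition f_wilf13 :=
  FAll (fun S => FImp (FAnd (f_semigroup S) (f_left_count S (numeral 13)))
    (FEx (fun c => FEx (fun e => FEx (fun t =>
       FAnd (f_conductor S c)
      (FAnd (f_embedding_dim S e)
      (FAnd (f_related3 (numeral 13) e t mul_graph) (f_le c t)))))))).

End Forcing.

Arguments numeral {P} one n.
Arguments opair {P} one x y.

Definition cell_name (a : cell) : name condition :=
  opair full_condition (numeral full_condition a.1) (numeral full_condition a.2).

(* The canonical name of the generic branch: the union, over the generic filter,
   of the (graphs of the) stems. *)
Definition generic_branch : name condition :=
  @Name _ {T : condition & 'I_(size (stem T))}
    (fun i => opair full_condition (numeral full_condition (tagged i))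
       (cell_name (nth (0, 0) (stem (tag i)) (tagged i))))
    (fun i => tag i).

(* The name of the ground-model set of the triples [(u, n, a)] such that [a], read
   at stage [n], shows a sound certificate of [R13 u]. *)
Definition sound_readings (producer verifier : prog) (sched : nat -> nat)
    : name condition :=
  ground full_condition
    (fun x : {x : nat * nat * cell |
        sound_reading producer verifier sched x.1.1 x.1.2 x.2} =>
       let: (u, n, a) := sval x in
       triple full_condition (numeral full_condition u)
         (numeral full_condition n) (cell_name a)).

Definition f_reads_all (producer verifier : prog) (sched : nat -> nat)
    : formula condition :=
  FAllIn (omega full_condition) (fun u =>
    FExIn (omega full_condition) (fun n => FEx (fun a =>
      FAnd (f_related n a generic_branch)
        (f_related3 u n a (sound_readings producer verifier sched))))).

(* Main.v *)
(* For a fixed code [u], the truth of [R13 u] makes producer and verifier halt,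
   for both parities, within some common bound; so every cell of a far enough
   quadrant is accepted at each stage of [u].  Shrinking the successor sets of a
   tree stage by stage gives (a).  A branch whose [n]-th cell lies in the [n]-th
   quadrant is accepted at all late stages of [u], and [u] recurs; this gives a
   decidable tree and a computable strategy without computing running times.
   For the forced statement: if a condition forces the complement of a name [S]
   in omega to be in bijection with a natural number, a stronger condition
   decides the finitely many values of that bijection.  It then decides every
   [n \in S], so that [S] is forced equal to a ground-model numerical semigroup
   and all the invariants can be computed in the ground model. *)

Require Import Defs.
From mathcomp Require Import finmap all_boot.
From mathcomp Require Import boolp classical_sets functions cardinality.

Set Implicit Arguments.
Unset Strict Implicit.
Unset Printing Implicit Defensive.

Local Open Scope classical_set_scope.

(** * Computable functions *)

Lemma outputs_comp1 f g xs y z :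
  outputs g xs y -> outputs f [:: y] z -> outputs (Comp f [:: g]) xs z.
Proof.
move=> [s gy] [t fz]; exists ((s + 0) + t).+1.
by apply: runs_comp fz; apply: runs_cons => //; exact: runs_nil.
Qed.

Lemma outputs_comp2 f g1 g2 xs y1 y2 z :
  outputs g1 xs y1 -> outputs g2 xs y2 -> outputs f [:: y1; y2] z ->
  outputs (Comp f [:: g1; g2]) xs z.
Proof.
move=> [s1 gy1] [s2 gy2] [t fz]; exists ((s1 + (s2 + 0)) + t).+1.
apply: runs_comp fz; apply: runs_cons => //; apply: runs_cons => //.
exact: runs_nil.
Qed.

Lemma outputs_rec f g xs (h : nat -> nat) :
  outputs f xs (h 0) -> (forall k, outputs g [:: k, h k & xs] (h k.+1)) ->
  forall k, outputs (Rec f g) (k :: xs) (h k).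
Proof.
move=> [t f0] gS; elim=> [|k [s IHk]]; first by exists t.+1; exact: runs_rec0.
by have [t' gk] := gS k; exists (s + t').+1; exact: runs_recS gk.
Qed.

Lemma outputs_mu f xs n :
  (forall k, k < n -> exists y, outputs f (k :: xs) y.+1) ->
  outputs f (n :: xs) 0 -> outputs (Mu f) xs n.
Proof.
move=> f_pos [t f0].
(* The run is assembled backwards from its successful last test at [n], so the induction is on the
   distance [k] to [n]. *)
suff search k : k <= n -> exists t', searches f xs (n - k) n t'.
  have [t' st'] := search n (leqnn n).
  by rewrite subnn in st'; exists t'.+1; exact: runs_mu.
elim: k => [|k IHk] kn.
  by rewrite subn0; exists t; exact: searches_stop.
have [t' st'] := IHk (ltnW kn).
have [|y [s fy]] := f_pos (n - k.+1).
  by rewrite ltn_subrL; exact: leq_ltn_trans kn.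
by exists (s + t'); apply: searches_next fy _; rewrite subnSK.
Qed.

Lemma outputs_zero xs : outputs Zero xs 0.
Proof. by exists 1; exact: runs_zero. Qed.

Lemma outputs_succ x : outputs Succ [:: x] x.+1.
Proof. by exists 1; exact: runs_succ. Qed.

Lemma outputs_proj i xs z : nth 0 xs i = z -> outputs (Proj i) xs z.
Proof. by move<-; exists 1; exact: runs_proj. Qed.

(** * Programs for elementary arithmetic *)

Definition p_add := Rec (Proj 0) (Comp Succ [:: Proj 1]).

Lemma outputs_add x y : outputs p_add [:: x; y] (x + y).
Proof.
apply: (outputs_rec (h := addn^~ y)) => [|k]; first exact: outputs_proj.
by apply: outputs_comp1; [exact: outputs_proj | exact: outputs_succ].
Qed.

Definition p_mul := Rec Zero (Comp p_add [:: Proj 1; Proj 2]).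

Lemma outputs_mul x y : outputs p_mul [:: x; y] (x * y).
Proof.
apply: (outputs_rec (h := muln^~ y)) => [|k]; first exact: outputs_zero.
rewrite mulSnr; apply: outputs_comp2; [exact: outputs_proj..|].
exact: outputs_add.
Qed.

Definition p_exp2 := Rec (Comp Succ [:: Zero]) (Comp p_add [:: Proj 1; Proj 1]).

Lemma outputs_exp2 x : outputs p_exp2 [:: x] (2 ^ x).
Proof.
apply: (outputs_rec (h := expn 2)) => [|k].
  by apply: outputs_comp1 (outputs_zero _) (outputs_succ _).
rewrite expnS mul2n -addnn; apply: outputs_comp2; [exact: outputs_proj..|].
exact: outputs_add.
Qed.

Definition p_pred := Rec Zero (Proj 0).

Lemma outputs_pred x : outputs p_pred [:: x] x.-1.
Proof.
apply: (outputs_rec (h := predn)) => [|k]; first exact: outputs_zero.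
exact: outputs_proj.
Qed.

(* The arguments come in the opposite order, since recursion is on the first. *)
Definition p_rsub := Rec (Proj 0) (Comp p_pred [:: Proj 1]).

Lemma outputs_rsub x y : outputs p_rsub [:: x; y] (y - x).
Proof.
apply: (outputs_rec (h := subn y)) => [|k].
  by apply: outputs_proj; rewrite subn0.
rewrite subnS.
by apply: outputs_comp1; [exact: outputs_proj | exact: outputs_pred].
Qed.

Definition p_is0 := Rec (Comp Succ [:: Zero]) Zero.

Lemma outputs_is0 x : outputs p_is0 [:: x] (x == 0).
Proof.
apply: (outputs_rec (h := fun x => nat_of_bool (x == 0))) => [|k].
  by apply: outputs_comp1 (outputs_zero _) (outputs_succ _).
exact: outputs_zero.
Qed.

Definition p_even := Rec (Comp Succ [:: Zero]) (Comp p_is0 [:: Proj 1]).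

Lemma outputs_even x : outputs p_even [:: x] (~~ odd x).
Proof.
apply: (outputs_rec (h := fun x => nat_of_bool (~~ odd x))) => [|k].
  by apply: outputs_comp1 (outputs_zero _) (outputs_succ _).
apply: outputs_comp1; first exact: outputs_proj.
by have := outputs_is0 (~~ odd k) => /=; case: odd.
Qed.

Definition p_half :=
  Rec Zero (Comp p_add [:: Comp p_is0 [:: Comp p_even [:: Proj 0]]; Proj 1]).

Lemma outputs_half x : outputs p_half [:: x] x./2.
Proof.
apply: (outputs_rec (h := half)) => [|k]; first exact: outputs_zero.
rewrite -[k.+1./2]/(uphalf k) uphalf_half.
apply: outputs_comp2; [|exact: outputs_proj|exact: outputs_add].
apply: (@outputs_comp1 _ _ _ (~~ odd k)); last first.
  by have := outputs_is0 (~~ odd k); case: odd.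
by apply: outputs_comp1; [exact: outputs_proj | exact: outputs_even].
Qed.

Definition p_shift := Rec (Proj 0) (Comp p_half [:: Proj 1]).

Lemma outputs_shift i x : outputs p_shift [:: i; x] (iter i half x).
Proof.
apply: (outputs_rec (h := fun i => iter i half x)) => [|k].
  exact: outputs_proj.
by apply: outputs_comp1; [exact: outputs_proj | exact: outputs_half].
Qed.

(** * Decoding of finite sequences *)

Lemma code_cons n s :
  CodeSeq.code (n :: s) = 2 ^ n * (CodeSeq.code s).*2.+1.
Proof. by []. Qed.

(** The head [n] is the exponent of two in the code, so each halving lowers it by one until an odd
    number is left. The head is thus read off as a number of halvings, and one more halving leaves
    the code of the tail. *)
Lemma iter_half_code k n s : k <= n ->
  iter k half (CodeSeq.code (n :: s)) = CodeSeq.code (n - k :: s).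
Proof.
elim: k => [|k IHk] kn; first by rewrite subn0.
rewrite iterS IHk 1?ltnW // !code_cons -(subnSK kn) expnS -mulnA mul2n.
by rewrite doubleK.
Qed.

Lemma odd_code n s : odd (CodeSeq.code (n :: s)) = (n == 0).
Proof. by rewrite code_cons oddM oddX /= odd_double andbT orbF. Qed.

(* The factor [x] makes the search stop at once on the code 0 of the empty
   sequence. *)
Definition p_head := Mu
  (Comp p_mul [:: Comp p_even [:: Comp p_shift [:: Proj 0; Proj 1]]; Proj 1]).

Lemma outputs_head s : outputs p_head [:: CodeSeq.code s] (head 0 s).
Proof.
pose f k x := ~~ odd (iter k half x) * x.
have fP k x : outputs (Comp p_mul
    [:: Comp p_even [:: Comp p_shift [:: Proj 0; Proj 1]]; Proj 1]) [:: k; x]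
  (f k x).
  apply: outputs_comp2; [|exact: outputs_proj|exact: outputs_mul].
  apply: outputs_comp1 (outputs_even _).
  by apply: outputs_comp2 (outputs_shift _ _); exact: outputs_proj.
case: s => [|n s]; apply: outputs_mu => //.
- move=> k kn; have := fP k (CodeSeq.code (n :: s)); rewrite /f.
  rewrite iter_half_code 1?ltnW // odd_code subn_eq0 -ltnNge kn mul1n.
  case E: CodeSeq.code => [|y]; last by exists y.
  by move/eqP: E; rewrite code_cons muln_eq0 expn_eq0.
- have := fP n (CodeSeq.code (n :: s)); rewrite /f.
  by rewrite iter_half_code // odd_code subnn.
Qed.

Definition p_behead := Comp p_half [:: Comp p_shift [:: p_head; Proj 0]].

Lemma outputs_behead s :
  outputs p_behead [:: CodeSeq.code s] (CodeSeq.code (behead s)).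
Proof.
have -> : CodeSeq.code (behead s) = (iter (head 0 s) half (CodeSeq.code s))./2.
  case: s => // n s; rewrite iter_half_code // subnn code_cons mul1n /=.
  by rewrite uphalf_double.
apply: outputs_comp1; last exact: outputs_half.
apply: outputs_comp2; [exact: outputs_head | exact: outputs_proj |].
exact: outputs_shift.
Qed.

Definition p_drop := Rec (Proj 0) (Comp p_behead [:: Proj 1]).

Lemma outputs_drop k s :
  outputs p_drop [:: k; CodeSeq.code s] (CodeSeq.code (drop k s)).
Proof.
apply: (outputs_rec (h := fun k => CodeSeq.code (drop k s))) => [|i].
  by rewrite drop0; exact: outputs_proj.
rewrite -[i.+1]add1n -drop_drop drop1.
by apply: outputs_comp1; [exact: outputs_proj | exact: outputs_behead].
Qed.

(** This makes the code itself a computable bound for the length, so no program has to compute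
    lengths. *)
Lemma size_le_code s : size s <= CodeSeq.code s.
Proof.
elim: s => //= n s IHs.
rewrite -[(size s).+1]mul1n leq_mul ?expn_gt0 // ltnS (leq_trans IHs) //.
by rewrite -addnn leq_addr.
Qed.

Lemma pickle_pair (x y : nat) : pickle (x, y) = CodeSeq.code [:: x; y].
Proof. by []. Qed.

Lemma pickle_seq_cell (t : seq cell) :
  pickle t = CodeSeq.code [seq CodeSeq.code [:: a.1; a.2] | a <- t].
Proof. by congr CodeSeq.code; apply: eq_map => -[]. Qed.

Definition in_stage_quadrants (t : seq cell) : Prop :=
  forall k, k < size t -> quadrant k (nth (0, 0) t k).

(** The truncated difference [k - x] vanishes exactly when [k <= x], so the property says that a sum
    of failures is zero. The sum runs up to the code of [t], which is at least its length; past the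
    end the factor [CodeSeq.code (drop k s)] is 0 and silences the failures. *)
Lemma computable_in_stage_quadrants :
  computable (fun t : seq cell => `[< in_stage_quadrants t >]).
Proof.
pose q_dist q := Comp p_rsub [:: q; Proj 0].
pose q_cell := Comp p_head [:: p_drop].
pose q_fail := Comp p_mul [:: p_drop; Comp p_add
  [:: q_dist (Comp p_head [:: q_cell]);
      q_dist (Comp p_head [:: Comp p_behead [:: q_cell]])]].
pose q_sum := Rec Zero (Comp p_add
  [:: Proj 1; Comp q_fail [:: Proj 0; Proj 2]]).
exists (Comp p_is0 [:: Comp q_sum [:: Proj 0; Proj 0]]) => t.
rewrite pickle_seq_cell; set s := map _ t; set x := CodeSeq.code s.
pose a k := nth (0, 0) t k.
pose fail k := CodeSeq.code (drop k s) * ((k - (a k).1) + (k - (a k).2)).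
have failP k : outputs q_fail [:: k; x] (fail k).
  have cellP : outputs q_cell [:: k; x] (head 0 (drop k s)).
    by apply: outputs_comp1 (outputs_drop _ _) (outputs_head _).
  (* Past the end of [t] the head is 0, the code of the empty sequence, whose decoded coordinates
     agree with the default cell [(0, 0)]. *)
  have coordP : exists2 b, head 0 (drop k s) = CodeSeq.code b &
      head 0 b = (a k).1 /\ head 0 (behead b) = (a k).2.
    rewrite -nth0 nth_drop addn0 /a; have [kt|tk] := ltnP k (size t).
      by rewrite (nth_map (0, 0)) //; eexists.
    by rewrite !nth_default ?size_map //; exists [::].
  have [b sb [b1 b2]] := coordP; rewrite sb in cellP.
  apply: outputs_comp2 (outputs_drop _ _) _ (outputs_mul _ _).
  apply: outputs_comp2 (outputs_add _ _); apply: outputs_comp2;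
    try exact: outputs_rsub; try exact: outputs_proj.
    by rewrite -b1; apply: outputs_comp1 cellP (outputs_head _).
  rewrite -b2; apply: outputs_comp1 (outputs_head _).
  exact: outputs_comp1 cellP (outputs_behead _).
have sumP k : outputs q_sum [:: k; x] (\sum_(i < k) fail i).
  apply: (outputs_rec (h := fun k => \sum_(i < k) fail i)) => [|i].
    by rewrite big_ord0; exact: outputs_zero.
  rewrite big_ord_recr /=; apply: outputs_comp2 (outputs_add _ _).
    exact: outputs_proj.
  by apply: outputs_comp2 (failP _); exact: outputs_proj.
apply: (@outputs_comp1 _ _ _ (\sum_(i < x) fail i)).
  by apply: outputs_comp2 (sumP x); exact: outputs_proj.
suff <- : (\sum_(i < x) fail i == 0) = `[< in_stage_quadrants t >].
  by have := outputs_is0 (\sum_(i < x) fail i); case: (_ == 0).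
rewrite sum_nat_eq0; apply/forallP/asboolP => [fail0 k kt|tq k].
  have kx : k < x.
    by apply: leq_trans kt _; have := size_le_code s; rewrite size_map.
  have := fail0 (Ordinal kx); rewrite /fail /= muln_eq0 addn_eq0 !subn_eq0.
  by rewrite (drop_nth 0) ?size_map // code_cons muln_eq0 expn_eq0 => /andP.
rewrite /= /fail muln_eq0 addn_eq0 !subn_eq0; have [kt|tk] := ltnP k (size t).
  by have [-> ->] := tq k kt; rewrite orbT.
by rewrite drop_oversize ?size_map.
Qed.

(** With [n] the input [pickle x], the output is the code of the pair [(n, n)], namely
    [2 ^ n * (2 ^ n + 2 ^ n + 1)]; the input never has to be decoded. *)
Lemma computable_diagonal :
  computable (fun x : seq (nat * cell) * nat => (pickle x, pickle x) : cell).
Proof.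
exists (Comp p_mul [:: p_exp2;
   Comp Succ [:: Comp p_add [:: p_exp2; p_exp2]]]) => x.
rewrite pickle_pair code_cons /= muln1 -addnn.
apply: outputs_comp2 (outputs_exp2 _) _ (outputs_mul _ _).
apply: outputs_comp1 (outputs_succ _).
by apply: outputs_comp2 (outputs_add _ _); exact: outputs_exp2.
Qed.

(** * Trees with large successor sets *)

Lemma mkseq_eq (g : nat -> cell) s n :
  size s = n -> (forall k, k < n -> nth (0, 0) s k = g k) -> s = mkseq g n.
Proof.
move=> sn gs; apply: (@eq_from_nth _ (0, 0)); first by rewrite size_mkseq.
by move=> k; rewrite sn => kn; rewrite nth_mkseq // gs.
Qed.

Lemma prefix_size_eq (T : eqType) (s t : seq T) :
  prefix s t -> size s = size t -> s = t.
Proof.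
by move=> /prefixP[u ->]; rewrite size_cat -{1}[size s]addn0 => /addnI;
   case: u => //; rewrite cats0.
Qed.

(** A choice of successors is iterated from [t]; the iterates form a chain of nodes whose limit is
    the branch. *)
Lemma branch_through (T : set (seq cell)) s t :
  (forall u v, prefix u v -> T v -> T u) ->
  (forall u, T u -> prefix s u -> exists a, T (rcons u a)) ->
  T t -> prefix s t -> exists2 g, body T g & t = mkseq g (size t).
Proof.
move=> Tcl Text Tt st.
have /choice[next nextP] u : exists a, T u -> prefix s u -> T (rcons u a).
  have [[Tu /(Text _ Tu)[a Ta]]|nTu] := pselect (T u /\ prefix s u).
    by exists a.
  by exists (0, 0) => Tu su; case: nTu.
pose F k := iter k (fun u => rcons u (next u)) t.
have FS k : F k.+1 = rcons (F k) (next (F k)) by [].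
have Fsize k : size (F k) = size t + k.
  by elim: k => [|k IHk]; rewrite ?addn0 // FS size_rcons IHk addnS.
have Fsub k l : prefix (F k) (F (k + l)).
  elim: l => [|l IHl]; first by rewrite addn0 prefix_refl.
  by rewrite addnS FS (prefix_trans IHl) // prefix_rcons.
have FT k : T (F k) /\ prefix s (F k).
  elim: k => [|k [IHk1 IHk2]] //; rewrite FS; split; first exact: nextP.
  by rewrite (prefix_trans IHk2) // prefix_rcons.
(* [F n.+1] is longer than [n] even when [t] is empty, so this entry is never the default. *)
pose g n := nth (0, 0) (F n.+1) n.
have Fg k n : n < size t + k -> nth (0, 0) (F k) n = g n.
  move=> nk; have nn : n < size (F n.+1) by rewrite Fsize addnS ltnS leq_addl.
  have [/subnKC E|/ltnW/subnKC E] := leqP k n.+1.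
    have /prefixP[w] := Fsub k (n.+1 - k); rewrite E /g => ->.
    by rewrite nth_cat Fsize nk.
  have /prefixP[w] := Fsub n.+1 (k - n.+1); rewrite E => ->.
  by rewrite nth_cat nn.
exists g; last by apply: mkseq_eq => // k kt; rewrite -(Fg 0) ?addn0.
move=> n; apply: (Tcl _ (F n)); last by case: (FT n).
have -> : mkseq g n = take n (F n); last exact: prefix_take.
apply/esym/mkseq_eq => [|k kn].
  by rewrite size_takel // Fsize leq_addl.
by rewrite nth_take // Fg // (leq_trans kn) // leq_addl.
Qed.

Section Quadrant_trees.
Variables (T : set (seq cell)) (s : seq cell).
Hypothesis Tcl : forall u v, prefix u v -> T v -> T u.
Hypothesis Ts : T s.
Hypothesis Tcmp : forall t, T t -> prefix t s || prefix s t.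
Hypothesis Tlarge : forall t, T t -> prefix s t ->
  exists N, quadrant N `<=` [set a | T (rcons t a)].

Let Text t : T t -> prefix s t -> exists a, T (rcons t a).
Proof.
move=> Tt /(Tlarge Tt)[N sub]; exists (N, N).
by apply: (sub (N, N)); split.
Qed.

(** Every quadrant contains two different cells, so the tree splits right above [s] and no longer
    node lies on all branches. A tree is therefore a condition as soon as its nodes are comparable
    with [s] and its successor sets above [s] are large. *)
Lemma quadrant_tree_is_stem : is_stem T s.
Proof.
split=> // [g gT|t Tt tall].
  have /Tcmp/orP[] := gT (size s) => [/prefix_size_eq|/prefix_size_eq] -> //;
    by rewrite size_mkseq.
rewrite leqNgt; apply/negP => st.
have [N sub] := Tlarge Ts (prefix_refl s).
have branch a : quadrant N a ->
    exists2 g, body T g & g (size s) = a.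
  move=> /sub Ta; have [|g gT E] := branch_through Tcl Text Ta.
    exact: prefix_rcons.
  exists g => //; have := congr1 (fun u => nth (0, 0) u (size s)) E.
  by rewrite nth_rcons ltnn eqxx nth_mkseq // size_rcons.
have [g gT g1] := branch (N, N) (conj (leqnn _) (leqnn _)).
have [h hT h1] := branch (N.+1, N.+1) (conj (leqnSn _) (leqnSn _)).
have : g (size s) = h (size s).
  by rewrite -[LHS](nth_mkseq (0, 0) g st) -[RHS](nth_mkseq (0, 0) h st)
     -(tall g gT) -(tall h hT).
by rewrite g1 h1 => -[/n_Sn].
Qed.

Definition quadrant_tree : condition :=
  Condition Tcl quadrant_tree_is_stem Tlarge.

End Quadrant_trees.

Lemma nodes_stem (T : condition) : nodes T (stem T).
Proof. by case: (stemP T). Qed.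

Lemma stem_body (T : condition) g :
  body (nodes T) g -> stem T = mkseq g (size (stem T)).
Proof. by case: (stemP T) => _ all _ _; exact: all. Qed.

Lemma nodes_comparable (T : condition) t :
  nodes T t -> prefix t (stem T) || prefix (stem T) t.
Proof. by case: (stemP T) => _ _ _; apply. Qed.

Lemma nodes_extend (T : condition) t N : nodes T t -> prefix (stem T) t ->
  exists2 a, quadrant N a & nodes T (rcons t a).
Proof.
move=> Tt /(nodes_large Tt)[M sub]; exists (maxn M N, maxn M N).
  by split; rewrite leq_maxr.
by apply: (sub (maxn M N, maxn M N)); split; rewrite leq_maxl.
Qed.

Lemma body_nonempty (T : condition) : exists g, body (nodes T) g.
Proof.
have [|g gT _] :=
  branch_through (@nodes_closed T) _ (nodes_stem T) (prefix_refl _).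
  by move=> t Tt /(nodes_extend 0 Tt)[a]; exists a.
by exists g.
Qed.

Lemma stronger_refl T : stronger T T.
Proof. by []. Qed.

Lemma stronger_trans T S U : stronger S T -> stronger T U -> stronger S U.
Proof. by move=> ST TU t /ST/TU. Qed.

Lemma stronger_full T : stronger T full_condition.
Proof. by []. Qed.

(** Every branch of [S] is a branch of [T], so the stem of [T] lies on all branches of [S], and the
    maximality of the stem of [S] bounds its length. Both stems are then initial segments of one
    branch. *)
Lemma stronger_stem S T : stronger S T -> prefix (stem T) (stem S).
Proof.
move=> ST; have [g gS] := body_nonempty S.
have gT : body (nodes T) g by move=> n; exact/ST/gS.
have TS : size (stem T) <= size (stem S).
  have [_ _ max _] := stemP S.
  apply: max => [|h hS]; first by rewrite (stem_body gT); exact: gS.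
  by apply: stem_body => n; exact/ST/hS.
rewrite (stem_body gT) (stem_body gS).
apply/prefixP; exists (drop (size (stem T)) (mkseq g (size (stem S)))).
rewrite -[LHS](cat_take_drop (size (stem T))); congr cat.
apply: mkseq_eq => [|k kT]; first by rewrite size_takel // size_mkseq.
by rewrite nth_take // nth_mkseq // (leq_trans kT).
Qed.

(** Two quadrants meet in the quadrant of the larger index, so pruning each successor set once, by
    the set of its stage, keeps all of them large. *)
Lemma restrict_stages (T : condition) (Q : nat -> set cell) :
  (forall n, exists N, quadrant N `<=` Q n) ->
  exists T' : condition, [/\ stronger T' T, stem T' = stem T &
    forall g, body (nodes T') g -> forall n, size (stem T) <= n -> Q n (g n)].
Proof.
move=> Qlarge.
pose A := [set t | nodes T t /\
  forall k, size (stem T) <= k < size t -> Q k (nth (0, 0) t k)].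
have Acl u v : prefix u v -> A v -> A u.
  move=> uv [Tv Qv]; split; first exact: nodes_closed Tv.
  move=> k /andP[Tk ku]; have /prefixP[w vE] := uv.
  have := Qv k; rewrite Tk vE size_cat nth_cat ku /=; apply.
  exact: leq_trans (leq_addr _ _).
have As : A (stem T).
  split; first exact: nodes_stem.
  by move=> k /andP[Tk kT]; have := leq_trans kT Tk; rewrite ltnn.
have Acmp t : A t -> prefix t (stem T) || prefix (stem T) t.
  by move=> [/nodes_comparable].
have Alarge t : A t -> prefix (stem T) t ->
    exists N, quadrant N `<=` [set a | A (rcons t a)].
  (* A cell appended to [t] is read at stage [size t]. *)
  move=> [Tt Qt] /(nodes_large Tt)[N subN]; have [M subM] := Qlarge (size t).
  exists (maxn N M) => a []; rewrite !geq_max => /andP[N1 M1] /andP[N2 M2].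
  split; first exact: (subN a).
  move=> k; rewrite size_rcons ltnS nth_rcons => /andP[Tk].
  case: ltngtP => // [kt _|-> _]; first by apply: Qt; rewrite Tk.
  exact: subM.
exists (quadrant_tree Acl As Acmp Alarge); split=> // [t [] //|g gA n Tn].
have [_ /(_ n)] := gA n.+1.
by rewrite size_mkseq ltnSn andbT nth_mkseq //; apply.
Qed.

(** The nodes comparable with [t] form the new tree: above [t] no successor is lost, and the large
    successor sets there make [t] the stem. *)
Lemma extend_stem (T : condition) t : nodes T t -> prefix (stem T) t ->
  exists2 T', stronger T' T & stem T' = t.
Proof.
move=> Tt st.
pose A := [set u | nodes T u /\ prefix u t || prefix t u].
have Acl u v : prefix u v -> A v -> A u.
  move=> uv [Tv cmp]; split; first exact: nodes_closed Tv.
  (* Both [u] and [t] are initial segments of one common node, so the shorter of them is an initial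
     segment of the other. *)
  have [ut|tu] := leqP (size u) (size t).
    move: cmp => /orP[vt|/prefixP[w E]]; first by rewrite (prefix_trans uv).
    move: uv => /prefixP[w' E']; apply/orP; left.
    have : take (size u) (u ++ w') = take (size u) (t ++ w) by rewrite -E -E'.
    by rewrite take_size_cat // takel_cat // => ->; exact: prefix_take.
  move: cmp => /orP[/(prefix_trans uv) -> //|/prefixP[w E]].
  move: uv => /prefixP[w' E']; apply/orP; right.
  have : take (size t) (u ++ w') = take (size t) (t ++ w) by rewrite -E -E'.
  by rewrite takel_cat 1?ltnW // take_size_cat // => <-; exact: prefix_take.
have As : A t by split=> //; rewrite prefix_refl.
have Acmp u : A u -> prefix u t || prefix t u by case.
have Alarge u : A u -> prefix t u ->
    exists N, quadrant N `<=` [set a | A (rcons u a)].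
  move=> [Tu _] tu; have [N sub] := nodes_large Tu (prefix_trans st tu).
  exists N => a /sub Ta; split=> //.
  by rewrite (prefix_trans tu) ?orbT // prefix_rcons.
by exists (quadrant_tree Acl As Acmp Alarge) => // u [].
Qed.

Lemma stem_longer (T : condition) n : size (stem T) <= n ->
  exists2 T', stronger T' T & size (stem T') = n.
Proof.
move=> /subnKC <-; elim: (n - _) => [|k [T' T'T szT']].
  by exists T; rewrite ?addn0.
have [a _ Ta] := nodes_extend 0 (nodes_stem T') (prefix_refl _).
have [T'' T''T' E] := extend_stem Ta (prefix_rcons _ _).
exists T''; first exact: stronger_trans T'T.
by rewrite E size_rcons szT' addnS.
Qed.

(** * Numerical semigroups *)

Lemma card_fset_set_seq (A : set nat) (X : seq nat) :
  uniq X -> (forall n, A n <-> n \in X) -> #|` fset_set A|%fset = size X.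
Proof.
move=> Xu AX; have fA : finite_set A.
  by apply: (sub_finite_set (B := [set` X])) => [n /AX //|]; exact: finite_seq.
have -> : fset_set A = [fset n in X]%fset.
  apply/fsetP => n; rewrite in_fset_set // !inE.
  by apply/idP/idP; rewrite inE AX.
by rewrite card_fseq undup_id.
Qed.

Lemma leastP (A : set nat) n : A n -> (forall y, A y -> n <= y) -> least A = n.
Proof.
move=> An nmin; apply: xget_unique => // m [Am mmin].
by apply/eqP; rewrite eqn_leq mmin // nmin.
Qed.

(** Finiteness ensures that [fset_set] in [embedding_dim] really lists the primitive elements.
    Beyond twice a bound [b] for the gaps, [n] splits as [b + (n - b)] inside [S]. *)
Lemma finite_primitive S : numerical_semigroup S -> finite_set (primitive S).
Proof.
move=> [_ _ /finite_seqP[X XE]].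
(* The successor puts [b] past every gap and also makes it positive, as a summand must be. *)
pose b := (\max_(x <- X) x).+1.
have big n : b <= n -> S n.
  move=> bn; apply: contrapT => nS.
  have nX : n \in X by have : (~` S) n by []; rewrite XE.
  by have := @leq_bigmax_seq _ X xpredT id n nX isT; rewrite leqNgt bn.
apply: (sub_finite_set (B := `I_(b + b))); last exact: finite_II.
move=> n [_ _ nprim] /=; rewrite ltnNge; apply/negP => bbn; apply: nprim.
exists b, (n - b); have bn : b <= n - b.
  by rewrite leq_subRL // (leq_trans _ bbn) ?leq_addr.
have bn' : b <= n by apply: leq_trans bbn; exact: leq_addr.
split; [by split=> //; exact: big| |by rewrite subnKC].
by split; [exact: big | apply: leq_trans bn].
Qed.

Lemma R13_of_wilf :
  (forall S, numerical_semigroup S -> left_count S = 13 ->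
     conductor S <= 13 * embedding_dim S) -> forall u, R13 u.
Proof.
move=> wilf u; rewrite /R13 /c_ /n_ /e_ /code_value.
case: asboolP => [uS|nS]; last by left=> -[].
by have [lc|nlc] := eqVneq (left_count (sgp u)) 13;
  [right; exact: wilf | left=> -[_ /eqP]; exact/negP].
Qed.

(** * Forcing over an arbitrary preorder *)

Section Forcing_theory.
Variables (P : Type) (le : P -> P -> Prop) (one : P).
Hypothesis le_refl : forall p, le p p.
Hypothesis le_trans : forall q p r, le p q -> le q r -> le p r.
Hypothesis le_one : forall p, le p one.

Local Notation "p '||-' A" := (forces le p A) (at level 70).
Local Notation eqf := (forces_eq le).
Local Notation memf := (forces_mem le).
Local Notation densely := (dense_below le).
Local Notation num := (numeral one).

(** * Density below a condition *)

Lemma densely_ret p (Q : P -> Prop) : (forall q, le q p -> Q q) -> densely p Q.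
Proof. by move=> Qp q qp; exists q => //; exact: Qp. Qed.

(** With [densely_ret] this makes density below a condition a modality: what is found densely may be
    used in proving another dense property, at the price of a further strengthening. *)
Lemma densely_bind p (Q R : P -> Prop) : densely p Q ->
  (forall q, le q p -> Q q -> densely q R) -> densely p R.
Proof.
move=> Qp QR q qp; have [r rq Qr] := Qp q qp.
have [s sr Rs] := QR r (le_trans rq qp) Qr r (le_refl r).
by exists s => //; exact: le_trans sr rq.
Qed.

Lemma densely_mono p q (Q : P -> Prop) : le q p -> densely p Q -> densely q Q.
Proof. by move=> qp Qp r rq; apply: Qp; exact: le_trans rq qp. Qed.

Lemma densely_ex p (Q : P -> Prop) : densely p Q -> exists2 q, le q p & Q q.
Proof. by apply. Qed.

Lemma densely_const p (A : Prop) : densely p (fun=> A) -> A.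
Proof. by move=> /densely_ex[]. Qed.

(** * Equality and membership of names *)

Lemma eqf_mono x y p q : le q p -> eqf x y p -> eqf x y q.
Proof.
case: x y => [I xs c] [J ys d] qp [xy yx]; split=> [i r rq|j r rq].
  by apply: xy; exact: le_trans rq qp.
by apply: yx; exact: le_trans rq qp.
Qed.

Lemma eqf_local x y p : densely p (eqf x y) -> eqf x y p.
Proof.
case: x y => [I xs c] [J ys d] xy; split=> [i q qp qi|j q qp qj].
  have [r rq [rxy _]] := xy q qp.
  have [s sr [j sj e]] := rxy i r (le_refl r) (le_trans rq qi).
  by exists s; [exact: le_trans sr rq | exists j].
have [r rq [_ ryx]] := xy q qp.
have [s sr [i si e]] := ryx j r (le_refl r) (le_trans rq qj).
by exists s; [exact: le_trans sr rq | exists i].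
Qed.

Lemma eqf_refl x p : eqf x x p.
Proof.
elim: x p => I xs IH c p.
by split=> i q qp qi; exists q => //; exists i.
Qed.

Lemma eqf_sym x y p : eqf x y p -> eqf y x p.
Proof.
elim: x y p => I xs IH c [J ys d] p [xy yx]; split=> [j q qp qj|i q qp qi].
  by have [r rq [i ri /IH e]] := yx j q qp qj; exists r => //; exists i.
by have [r rq [j rj /IH e]] := xy i q qp qi; exists r => //; exists j.
Qed.

Lemma eqf_trans y x z p : eqf x y p -> eqf y z p -> eqf x z p.
Proof.
elim: x y z p => I xs IH c [J ys d] [K zs e] p [xy yx] [yz zy].
split=> [i q qp qi|k q qp qk].
  have [r rq [j rj xyr]] := xy i q qp qi.
  have [s sr [k sk yzs]] := yz j r (le_trans rq qp) rj.
  exists s; first exact: le_trans sr rq.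
  by exists k => //; apply: IH yzs; exact: eqf_mono sr xyr.
have [r rq [j rj yzr]] := zy k q qp qk.
have [s sr [i si xys]] := yx j r (le_trans rq qp) rj.
exists s; first exact: le_trans sr rq.
by exists i => //; apply: (IH _ _ _ _ xys); exact: eqf_mono sr yzr.
Qed.

Lemma memf_mono x y p q : le q p -> memf x y p -> memf x y q.
Proof. by case: y => J ys d; exact: densely_mono. Qed.

Lemma memf_local x y p : densely p (memf x y) -> memf x y p.
Proof. by case: y => J ys d xy; apply: densely_bind xy _ => q qp. Qed.

Lemma memf_intro J (ys : J -> name P) d j p :
  le p (d j) -> memf (ys j) (Name ys d) p.
Proof.
move=> pj; apply: densely_ret => q qp.
by exists j; [exact: le_trans qp pj | exact: eqf_refl].
Qed.

Lemma memf_eql x x' y p : eqf x x' p -> memf x y p -> memf x' y p.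
Proof.
case: y => J ys d xx' xy; apply: densely_bind xy _ => q qp [j qj e].
apply: densely_ret => r rq; exists j; first exact: le_trans rq qj.
apply: eqf_trans (eqf_mono rq e).
by apply/eqf_sym; apply: eqf_mono xx'; exact: le_trans rq qp.
Qed.

Lemma memf_eqr x y y' p : eqf y y' p -> memf x y p -> memf x y' p.
Proof.
case: y y' => J ys d [K zs c] [yz _] xy; apply: densely_bind xy _.
move=> q qp [j qj e] r rq.
have [s sr [k sk ejk]] := yz j r (le_trans rq qp) (le_trans rq qj).
exists s => //; exists k => //; apply: eqf_trans ejk.
by apply: eqf_mono e; exact: le_trans sr rq.
Qed.

Lemma eqf_ext x y p :
  (forall q z, le q p -> (memf z x q <-> memf z y q)) -> eqf x y p.
Proof.
case: x y => [I xs c] [J ys d] xy; split=> [i q qp qi|j q qp qj].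
  have [+ _] := xy q (xs i) qp.
  by move=> /(_ (memf_intro _ qi)) /(_ q (le_refl q)).
have [_ +] := xy q (ys j) qp.
move=> /(_ (memf_intro _ qj)) /(_ q (le_refl q)) [r rq [i ri e]].
by exists r => //; exists i => //; exact: eqf_sym.
Qed.

(** * Strengthening and locality of forced formulas *)

Lemma forces_mono A p q : le q p -> p ||- A -> q ||- A.
Proof.
elim: A p q => [x y|x y||A IHA B IHB|A IHA B IHB|A IHA B IHB|F IH|F IH] p q qp.
- exact: eqf_mono.
- exact: memf_mono.
- by [].
- by move=> [/(IHA _ _ qp) ? /(IHB _ _ qp)].
- exact: densely_mono.
- by move=> AB r rq; apply: AB; exact: le_trans rq qp.
- by move=> H x; exact: IH (H x).
- exact: densely_mono.
Qed.

Lemma forces_local A p : densely p (fun q => q ||- A) -> p ||- A.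
Proof.
elim: A p => [x y|x y||A IHA B IHB|A IHA B IHB|A IHA B IHB|F IH|F IH] p H.
- exact: eqf_local.
- exact: memf_local.
- exact: densely_const H.
- by split; [apply: IHA | apply: IHB]; apply: densely_bind H _ => q _ [a b];
    apply: densely_ret => r rq; exact: forces_mono rq _.
- exact: densely_bind H _.
- move=> q qp Aq; apply: IHB; apply: densely_bind (densely_mono qp H) _.
  move=> r rq AB; apply: densely_ret => s sr; apply: AB => //.
  by apply: forces_mono Aq; exact: le_trans sr rq.
- move=> x; apply: IH; apply: densely_bind H _ => q _ Hq.
  by apply: densely_ret => r rq; exact: forces_mono rq (Hq x).
- exact: densely_bind H _.
Qed.

(** The usual way to use a forced existence or disjunction: pass to the densely many conditions that
    decide a witness, and force [A] there. *)
Lemma forces_by p (Q : P -> Prop) A :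
  densely p Q -> (forall q, le q p -> Q q -> q ||- A) -> p ||- A.
Proof.
move=> Qp QA; apply: forces_local; apply: densely_bind Qp _ => q qp /(QA q qp).
by move=> Aq; apply: densely_ret => r rq; exact: forces_mono Aq.
Qed.

(** The forced logic is classical: a condition below which nothing forces [A] forces its
    negation. *)
Lemma forces_notnot p A : (forall q, le q p -> ~ q ||- FNot A) -> p ||- A.
Proof.
move=> nnA; apply: forces_local => q qp; apply: contrapT => nA.
by apply: (nnA q qp) => r rq Ar; apply: nA; exists r.
Qed.

Lemma forces_ex_intro p (F : name P -> formula P) x :
  p ||- F x -> p ||- FEx F.
Proof.
by move=> Fx; apply: densely_ret => q qp; exists x; exact: forces_mono Fx.
Qed.

Lemma forces_exin_intro p y (F : name P -> formula P) x :
  memf x y p -> p ||- F x -> p ||- FExIn y F.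
Proof. by move=> xy Fx; apply: (forces_ex_intro (x := x)). Qed.

(** * Names of pairs, naturals and arithmetic graphs *)

Lemma memf_ground I (xs : I -> name P) x p :
  memf x (ground one xs) p <-> densely p (fun q => exists i, eqf x (xs i) q).
Proof.
split=> H; apply: densely_bind H _ => q qp [i].
  by move=> _ e; apply: densely_ret => r rq; exists i; exact: eqf_mono e.
move=> e; apply: densely_ret => r rq; exists i; first exact: le_one.
exact: eqf_mono e.
Qed.

Lemma memf_ground_intro I (xs : I -> name P) i p :
  memf (xs i) (ground one xs) p.
Proof. exact: memf_intro. Qed.

Lemma memf_upair z x y p : memf z (upair one x y) p <->
  densely p (fun q => eqf z x q \/ eqf z y q).
Proof.
rewrite memf_ground; split=> H; apply: densely_bind H _ => q qp.
  by case=> -[] e; apply: densely_ret => r rq; [left|right]; exact: eqf_mono e.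
by case=> e; apply: densely_ret => r rq; [exists true|exists false];
  exact: eqf_mono e.
Qed.

Lemma eqf_upair x x' y y' p : eqf x x' p -> eqf y y' p ->
  eqf (upair one x y) (upair one x' y') p.
Proof.
have sub u u' v v' q z : eqf u u' q -> eqf v v' q ->
    memf z (upair one u v) q -> memf z (upair one u' v') q.
  move=> uu' vv'; rewrite !memf_upair => H; apply: densely_bind H _ => r rq e.
  apply: densely_ret => s sr; have sq := le_trans sr rq.
  case: e => e; [left|right]; apply: eqf_trans (eqf_mono sr e) _;
    exact: eqf_mono sq _.
move=> xx' yy'; apply: eqf_ext => q z qp.
by split; apply: sub; try exact: eqf_mono qp _; apply: eqf_sym;
  exact: eqf_mono qp _.
Qed.

Lemma eqf_opair x x' y y' p : eqf x x' p -> eqf y y' p ->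
  eqf (opair one x y) (opair one x' y') p.
Proof. by move=> xx' yy'; apply: eqf_upair; apply: eqf_upair. Qed.

Lemma forces_upair p w x y : p ||- f_upair w x y <-> eqf w (upair one x y) p.
Proof.
split=> [H|e z]; first apply: eqf_ext => q z qp.
  have [to from] := H z; split=> [/(to q qp)|]; rewrite memf_upair //.
  exact: (from q qp).
split=> q qp.
  by move=> /(memf_eqr (eqf_mono qp e)) /memf_upair.
by move=> zxy; apply: memf_eqr (eqf_sym (eqf_mono qp e)) _; rewrite memf_upair.
Qed.

Lemma forces_pair p w x y : p ||- f_pair w x y <-> eqf w (opair one x y) p.
Proof.
split=> [H|e].
  apply: eqf_local; apply: densely_bind H _ => q qp [a H].
  apply: densely_bind H _ => r rq [b [/forces_upair ea [/forces_upair eb]]].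
  move=> /forces_upair e; apply: densely_ret => s sr; apply: eqf_mono sr _.
  exact: eqf_trans e (eqf_upair ea eb).
apply: (forces_ex_intro (x := upair one x x)).
apply: (forces_ex_intro (x := upair one x y)).
by split; [|split]; rewrite forces_upair //; exact: eqf_refl.
Qed.

Lemma forces_related p x y f :
  p ||- f_related x y f <-> memf (opair one x y) f p.
Proof.
split=> [H|xyf].
  apply: memf_local; apply: densely_bind H _ => q qp [w [wf /forces_pair e]].
  by apply: densely_ret => r rq; apply: memf_mono rq _; exact: memf_eql wf.
by apply: forces_exin_intro xyf _; apply/forces_pair/eqf_refl.
Qed.

Lemma forces_related3 p x y z f :
  p ||- f_related3 x y z f <-> memf (triple one x y z) f p.
Proof.
split=> [H|xyf].
  apply: memf_local; apply: densely_bind H _ => q qp [v [vf H]].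
  apply: densely_bind H _ => r rq [w [/forces_pair wE /forces_pair vE]].
  apply: densely_ret => s sr; apply: memf_mono sr _.
  apply: memf_eql (memf_mono rq vf); apply: eqf_trans vE _.
  exact: eqf_opair (eqf_refl _ _) wE.
apply: forces_exin_intro xyf _.
by apply: (forces_ex_intro (x := opair one y z)); split;
  apply/forces_pair/eqf_refl.
Qed.

(** Each element of either pair is densely equal to an element of the other, and these four choices
    determine a matching. Which matching holds may vary with the stronger condition, hence the
    density. *)
Lemma upair_inj x x' y y' p : eqf (upair one x y) (upair one x' y') p ->
  densely p (fun q =>
    eqf x x' q /\ eqf y y' q \/ eqf x y' q /\ eqf y x' q).
Proof.
have left_mem u v q : memf u (upair one u v) q.
  by rewrite memf_upair; apply: densely_ret => r _; left; exact: eqf_refl.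
have right_mem u v q : memf v (upair one u v) q.
  by rewrite memf_upair; apply: densely_ret => r _; right; exact: eqf_refl.
move=> e.
have /memf_upair Hx := memf_eqr e (left_mem x y p).
have /memf_upair Hy := memf_eqr e (right_mem x y p).
have /memf_upair Hx' := memf_eqr (eqf_sym e) (left_mem x' y' p).
have /memf_upair Hy' := memf_eqr (eqf_sym e) (right_mem x' y' p).
apply: densely_bind Hx _ => q qp ex.
apply: densely_bind (densely_mono qp Hy) _ => r rq ey.
have rp := le_trans rq qp; apply: densely_bind (densely_mono rp Hx') _ => s sr.
move=> ex'; have sp := le_trans sr rp.
apply: densely_bind (densely_mono sp Hy') _ => t ts ey'.
have tr := le_trans ts sr; have tq := le_trans tr rq.
apply: densely_ret => u ut; have us := le_trans ut ts.
have ur := le_trans us sr; have uq := le_trans ur rq.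
case: ex => /(eqf_mono uq) ex; case: ey => /(eqf_mono ur) ey.
- case: ey' => /(eqf_mono ut) ey'; last by left; split=> //; exact: eqf_sym.
  left; split=> //; apply: eqf_trans ey _; apply: eqf_trans (eqf_sym ex) _.
  exact: eqf_sym.
- by left.
- by right.
- case: ex' => /(eqf_mono us) ex'; last by right; split=> //; exact: eqf_sym.
  right; split=> //; apply: eqf_trans ey _; apply: eqf_trans (eqf_sym ex) _.
  exact: eqf_sym.
Qed.

(** The crossed matching of the two Kuratowski components forces [x], [y], [x'] and [y'] all equal,
    so both matchings give the same conclusion, and locality of equality removes the density. *)
Lemma opair_inj x x' y y' p : eqf (opair one x y) (opair one x' y') p ->
  eqf x x' p /\ eqf y y' p.
Proof.
move=> e; suff H : densely p (fun q => eqf x x' q /\ eqf y y' q).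
  split; apply: eqf_local; apply: densely_bind H _ => q qp [ex ey];
    by apply: densely_ret => r rq; exact: eqf_mono rq _.
apply: densely_bind (upair_inj e) _ => q qp [[e1 e2]|[e1 e2]].
  apply: densely_bind (upair_inj e1) _ => r rq ex.
  have {}ex : eqf x x' r by case: ex => -[].
  apply: densely_bind (densely_mono rq (upair_inj e2)) _ => s sr ey.
  apply: densely_ret => t ts; have ext := eqf_mono (le_trans ts sr) ex.
  split=> //; case: ey => -[/(eqf_mono ts) e3 /(eqf_mono ts) e4] //.
  exact: eqf_trans e4 (eqf_trans (eqf_sym ext) e3).
apply: densely_bind (upair_inj e1) _ => r rq ex.
have {}ex : eqf x x' r /\ eqf x y' r by case: ex => -[].
apply: densely_bind (densely_mono rq (upair_inj e2)) _ => s sr ey.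
apply: densely_ret => t ts; case: ex => ex exy'.
have tr := le_trans ts sr; split; first exact: eqf_mono ex.
have yx' : eqf y x' t by case: ey => -[_ e4]; exact: eqf_mono e4.
apply: eqf_trans yx' (eqf_trans (eqf_sym (eqf_mono tr ex)) _).
exact: eqf_mono exy'.
Qed.

Lemma memf_adjoin z x y p : memf z (adjoin one x y) p <->
  densely p (fun q => eqf z y q \/ memf z x q).
Proof.
case: x => I xs c; split=> H; apply: densely_bind H _ => q qp.
  case=> -[i|] /= qi e; apply: densely_ret => r rq; last first.
    by left; exact: eqf_mono e.
  right; apply: densely_ret => s sr; exists i.
    by apply: le_trans qi; exact: le_trans rq.
  by apply: eqf_mono e; exact: le_trans rq.
case=> [e|zx]; first by apply: densely_ret => r rq; exists None => //;
  exact: eqf_mono e.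
by apply: densely_bind zx _ => r rq [i ri e]; apply: densely_ret => s sr;
  exists (Some i); [exact: le_trans ri | exact: eqf_mono e].
Qed.

Lemma memf_numeral x n p : memf x (num n) p <->
  densely p (fun q => exists2 k, k < n & eqf x (num k) q).
Proof.
elim: n p => [|n IHn] p.
  by rewrite memf_ground; split=> H; apply: densely_bind H _ => q qp [].
rewrite memf_adjoin; split=> H; apply: densely_bind H _ => q qp.
  case=> [e|/IHn H]; first by apply: densely_ret => r rq; exists n => //;
    exact: eqf_mono e.
  by apply: densely_bind H _ => r rq [k kn e]; apply: densely_ret => s sr;
    exists k; [exact: ltnW | exact: eqf_mono e].
case=> k; rewrite ltnS leq_eqVlt => /orP[/eqP->|kn] e.
  by apply: densely_ret => r rq; left; exact: eqf_mono e.
apply: densely_ret => r rq; right; apply/IHn; apply: densely_ret => s sr.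
by exists k => //; apply: eqf_mono e; exact: le_trans rq.
Qed.

(** Of two different numerals the smaller is a member of the larger, so their equality would force a
    numeral to be a member of itself. That is refuted by descent: [num k] in itself equals some
    [num l] with [l < k], which is then in itself too. *)
Lemma eqf_num m n p : eqf (num m) (num n) p -> m = n.
Proof.
have irrefl k q : ~ memf (num k) (num k) q.
  elim/ltn_ind: k q => k IH q /memf_numeral/densely_ex[r rq [l lk e]].
  have kl : memf (num l) (num k) r.
    apply/memf_numeral; apply: densely_ret => s sr.
    by exists l => //; exact: eqf_refl.
  exact: IH lk r (memf_eqr e kl).
have lt_neq k l q : k < l -> ~ eqf (num k) (num l) q.
  move=> kl e; apply: (irrefl k q); apply: memf_eqr (eqf_sym e) _.
  apply/memf_numeral; apply: densely_ret => r rq.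
  by exists k => //; exact: eqf_refl.
by case: (ltngtP m n) => // [/lt_neq mn /mn|/lt_neq nm /eqf_sym/nm].
Qed.

Lemma memf_num m n p : memf (num m) (num n) p <-> m < n.
Proof.
rewrite memf_numeral; split=> [/densely_ex[q _ [k kn /eqf_num->]] //|mn].
by apply: densely_ret => q qp; exists m => //; exact: eqf_refl.
Qed.

Lemma memf_omega x p :
  memf x (omega one) p <-> densely p (fun q => exists n, eqf x (num n) q).
Proof. exact: memf_ground. Qed.

Lemma memf_num_omega n p : memf (num n) (omega one) p.
Proof. exact: memf_ground_intro. Qed.

Lemma forces_le m n p : p ||- f_le (num m) (num n) <-> m <= n.
Proof.
split=> [/densely_ex[q _ []]|mn].
- by move/memf_num/ltnW.
- by move/eqf_num->.
apply: densely_ret => q qp; move: mn; rewrite leq_eqVlt => /orP[/eqP->|mn].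
  by right; exact: eqf_refl.
by left; apply/memf_num.
Qed.

Lemma forces_graph (g : nat * nat -> nat) a b c p :
  p ||- f_related3 (num a) (num b) (num c) (ground one
    (fun x => triple one (num x.1) (num x.2) (num (g x)))) <-> c = g (a, b).
Proof.
rewrite forces_related3; split=> [/memf_ground/densely_ex[q _ [[a' b']]]|->].
  by case/opair_inj=> /eqf_num-> /opair_inj[/eqf_num-> /eqf_num].
exact: (memf_ground_intro (fun x => triple one (num x.1) (num x.2) (num (g x)))
  (a, b)).
Qed.

Lemma forces_add a b c p :
  p ||- f_related3 (num a) (num b) (num c) (add_graph one) <-> c = a + b.
Proof. exact: forces_graph. Qed.

Lemma forces_mul a b c p :
  p ||- f_related3 (num a) (num b) (num c) (mul_graph one) <-> c = a * b.
Proof. exact: (forces_graph (fun x => x.1 * x.2)). Qed.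

(** * Deciding and counting classes of naturals *)

Definition decided p (A : name P -> formula P) (X : set nat) : Prop :=
  (forall n, X n -> p ||- A (num n)) /\
  (forall n, ~ X n -> p ||- FNot (A (num n))).

Lemma decided_true p q A X n :
  decided p A X -> le q p -> q ||- A (num n) -> X n.
Proof.
move=> [_ AN] qp An; apply: contrapT => /AN nA; exact: nA q qp An.
Qed.

Lemma decided_mono p q A X : le q p -> decided p A X -> decided q A X.
Proof.
move=> qp [A1 A2]; split=> n => [/A1|/A2]; exact: forces_mono.
Qed.

(** A class is an arbitrary function from names to formulas, and such a function might distinguish
    names that are forced equal. *)
Definition extensional (A : name P -> formula P) : Prop :=
  forall q x y, eqf x y q -> q ||- A x -> q ||- A y.

Definition subset_omega p (A : name P -> formula P) : Prop :=
  forall q x, le q p -> q ||- A x -> memf x (omega one) q.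

(* Deciding the values of the bijection at the finitely many arguments below [k]
   decides [A]. *)
Lemma card_decided p k A : extensional A -> subset_omega p A ->
  p ||- f_card one k A ->
  densely p (fun q => exists X : seq nat,
    [/\ uniq X, eqf k (num (size X)) q & decided q A [set n | n \in X]]).
Proof.
move=> Aext Aom [kom H]; move/memf_omega: kom => kom.
apply: densely_bind kom _ => q qp [K kK].
apply: densely_bind (densely_mono qp H) _ => r rq [f [B1 [B2 [B3 B4]]]].
have rp := le_trans rq qp.
have in_k m s : m < K -> le s r -> memf (num m) k s.
  move=> mK sr; apply: memf_eqr (eqf_sym (eqf_mono (le_trans sr rq) kK)) _.
  exact/memf_num.
(* The values are decided one after the other, each below the condition that decided the earlier
   ones; [K] is a fixed natural number, so finitely many strengthenings suffice. *)
have values m : m <= K -> densely r (fun s => exists2 X : seq nat, size X = m &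
    forall j, j < m -> s ||- A (num (nth 0 X j)) /\
      s ||- f_related (num j) (num (nth 0 X j)) f).
  elim: m => [|m IHm] mK; first by apply: densely_ret => s sr; exists [::].
  apply: densely_bind (IHm (ltnW mK)) _ => s sr [X Xm XP].
  apply: densely_bind (B1 _ s sr (in_k m s mK sr)) _ => t ts [x [Ax Rx]].
  have tp := le_trans ts (le_trans sr rp).
  have xom := Aom t x tp Ax; move/memf_omega: xom => xom.
  apply: densely_bind xom _ => u ut [n xn]; apply: densely_ret => v vu.
  exists (rcons X n); first by rewrite size_rcons Xm.
  move=> j; rewrite ltnS leq_eqVlt => /orP[/eqP->|jm].
    rewrite nth_rcons Xm ltnn eqxx; have vt := le_trans vu ut; split.
      exact: Aext (eqf_mono vu xn) (forces_mono vt Ax).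
    apply/forces_related; apply: memf_eql (eqf_opair (eqf_refl _ _) _) _.
      exact: eqf_mono vu xn.
    by apply/forces_related; apply: forces_mono vt _; exact: Rx.
  rewrite nth_rcons Xm jm; have vs := le_trans vu (le_trans ut ts).
  by have [X1 X2] := XP j jm; split;
    [exact: forces_mono vs X1 | exact: forces_mono vs X2].
apply: densely_bind (values K (leqnn K)) _ => s sr [X XK XP].
have kX : eqf k (num (size X)) s.
  by rewrite XK; apply: eqf_mono kK; exact: le_trans sr rq.
suff [Xu XA] : uniq X /\ decided s A [set n | n \in X].
  apply: densely_ret => t ts; exists X; split=> //; first exact: eqf_mono kX.
  exact: decided_mono ts XA.
split.
  apply/(uniqP 0) => i j; rewrite !inE XK => iK jK ij.
  have [_ Ri] := XP i iK; have [_ Rj] := XP j jK; rewrite -ij in Rj.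
  apply: eqf_num (B4 _ s sr (in_k _ _ iK sr) _ s (le_refl s)
    (in_k _ _ jK sr) _ s (le_refl s) Ri s (le_refl s) Rj).
split=> n /= nX.
  by rewrite -[n](nth_index 0 nX); have [|//] := XP (index n X);
    rewrite -XK index_mem.
(* If [n] were forced into the class, surjectivity would give it a preimage in [k], densely a
   numeral [j] below [K]; functionality then makes [n] the [j]-th entry of [X]. *)
move=> t ts An; have tr := le_trans ts sr.
have [u ut [i [ik Ri]]] := densely_ex (B2 _ t tr An).
have uq := le_trans (le_trans ut tr) rq.
have /memf_numeral/densely_ex[v vu [j jK ij]] :=
  memf_eqr (eqf_mono uq kK) ik.
have [_ /(forces_mono (le_trans vu (le_trans ut ts))) Rj] := XP j jK.
have vr := le_trans (le_trans vu ut) tr.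
have Rjn : v ||- f_related (num j) (num n) f.
  apply/forces_related; apply: memf_eql (eqf_opair ij (eqf_refl _ _)) _.
  by apply/forces_related; apply: forces_mono vu _; exact: Ri.
have := B3 _ v vr (in_k _ _ jK vr) _ _ v (le_refl v) Rj v (le_refl v) Rjn.
by move/eqf_num => nE; rewrite -nE mem_nth // XK in nX.
Qed.

(** This is the converse of [card_decided]: the ground-model graph of the enumeration [X] names the
    bijection. *)
Lemma card_intro p A (X : seq nat) : extensional A -> subset_omega p A ->
  uniq X -> decided p A [set n | n \in X] ->
  p ||- f_card one (num (size X)) A.
Proof.
move=> Aext Aom Xu XA; split; first exact: memf_num_omega.
pose f :=
  ground one (fun i : 'I_(size X) => opair one (num i) (num (nth 0 X i))).
(* Up to density the related pairs are exactly the listed ones; each clause of the bijection is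
   reduced to this. *)
have relP q x y : q ||- f_related x y f <-> densely q (fun r =>
    exists2 i, i < size X & eqf x (num i) r /\ eqf y (num (nth 0 X i)) r).
  rewrite forces_related memf_ground.
  split=> H; apply: densely_bind H _ => r rq.
    move=> [i /opair_inj[xi yi]]; apply: densely_ret => s sr.
    by exists i => //; split; exact: eqf_mono sr _.
  move=> [i iX [xi yi]]; apply: densely_ret => s sr.
  by exists (Ordinal iX); apply: eqf_opair; exact: eqf_mono sr _.
have relI q i : i < size X -> q ||- f_related (num i) (num (nth 0 X i)) f.
  move=> iX; apply/relP; apply: densely_ret => r rq; exists i => //.
  by split; exact: eqf_refl.
have total i q : le q p -> memf i (num (size X)) q ->
    q ||- FEx (fun x => FAnd (A x) (f_related i x f)).
  move=> qp /memf_numeral iX; apply: forces_by iX _ => r rq [j jX ij].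
  apply: (forces_ex_intro (x := num (nth 0 X j))); split.
    apply: (forces_mono (le_trans rq qp)).
    by have [+ _] := XA; apply; exact: mem_nth.
  apply/forces_related.
  apply: memf_eql (eqf_opair (eqf_sym ij) (eqf_refl _ _)) _.
  exact/forces_related/relI.
have onto x q : le q p -> q ||- A x ->
    q ||- FExIn (num (size X)) (fun i => f_related i x f).
  move=> qp Ax; have /memf_omega xom := Aom q x qp Ax.
  apply: forces_by xom _ => r rq [n xn].
  have rp := le_trans rq qp.
  have nX := decided_true XA rp (Aext _ _ _ xn (forces_mono rq Ax)).
  have iX : index n X < size X by rewrite index_mem.
  apply: (forces_exin_intro (x := num (index n X))); first exact/memf_num.
  apply/forces_related.
  apply: memf_eql (eqf_opair (eqf_refl _ _) (eqf_sym xn)) _.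
  by apply/forces_related; have := relI r _ iX; rewrite nth_index.
have functional i x y q : q ||- f_related i x f -> q ||- f_related i y f ->
    q ||- FEq x y.
  move=> /relP Rx /relP Ry; apply: (forces_by Rx) => r rq [j jX [ij xj]].
  apply: (forces_by (densely_mono rq Ry)) => s sr [l lX [il yl]].
  have jl : j = l by apply: eqf_num (eqf_trans (eqf_sym (eqf_mono sr ij)) il).
  by apply: eqf_trans (eqf_mono sr xj) _; rewrite jl; exact: eqf_sym.
have injective i j x q : q ||- f_related i x f -> q ||- f_related j x f ->
    q ||- FEq i j.
  move=> /relP Ri /relP Rj; apply: (forces_by Ri) => r rq [k kX [ik xk]].
  apply: (forces_by (densely_mono rq Rj)) => s sr [l lX [jl xl]].
  have /eqP : nth 0 X k = nth 0 X l.
    exact: eqf_num (eqf_trans (eqf_sym (eqf_mono sr xk)) xl).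
  rewrite nth_uniq // => /eqP kl.
  by apply: eqf_trans (eqf_mono sr ik) _; rewrite kl; exact: eqf_sym.
apply: (forces_ex_intro (x := f)); split; [|split; [|split]].
- by move=> i q qp; exact: total.
- by move=> x q qp; exact: onto.
- move=> i q qp _ x y r _ Rx s sr; apply: functional.
  by apply: forces_mono sr _; exact: Rx.
- move=> i q qp _ j r rq _ x s sr Ri t ts; apply: injective.
  by apply: forces_mono ts _; exact: Ri.
Qed.

(** * Absoluteness of the semigroup invariants *)

Lemma extensional_le_l y : extensional (fun x => f_le x y).
Proof.
move=> q x x' xx' H; apply: densely_bind H _ => r rq xy.
apply: densely_ret => s sr; have sq := le_trans sr rq.
case: xy => [/(memf_mono sr)|/(eqf_mono sr)] xy; [left|right].
  exact: memf_eql (eqf_mono sq xx') xy.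
exact: eqf_trans (eqf_sym (eqf_mono sq xx')) xy.
Qed.

Lemma extensional_le_r x : extensional (fun y => f_le x y).
Proof.
move=> q y y' yy' H; apply: densely_bind H _ => r rq xy.
apply: densely_ret => s sr; have sq := le_trans sr rq.
case: xy => [/(memf_mono sr)|/(eqf_mono sr)] xy; [left|right].
  exact: memf_eqr (eqf_mono sq yy') xy.
exact: eqf_trans xy (eqf_mono sq yy').
Qed.

Lemma extensional_notmem S :
  extensional (fun x => FAnd (FMem x (omega one)) (FNot (FMem x S))).
Proof.
move=> q x y xy [xom xS]; split; first exact: memf_eql xom.
move=> r rq yS; apply: (xS r rq); apply: memf_eql yS.
exact: eqf_sym (eqf_mono rq xy).
Qed.

Lemma extensional_primitive S : extensional (f_primitive one S).
Proof.
move=> q x y xy [xS [x0 xprim]]; split; first exact: memf_eql xS.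
split=> r rq.
  by move=> y0; apply: (x0 r rq); apply: eqf_trans y0; exact: eqf_mono xy.
move=> H; apply: (xprim r rq); apply: densely_bind H _ => s sr [a [aS H]].
apply: densely_ret => t ts; exists a; split; first exact: memf_mono aS.
apply: densely_bind (densely_mono ts H) _ => u ut [b [bS [a0 [b0 ab]]]].
apply: densely_ret => v vu; exists b; split; first exact: memf_mono bS.
split; first exact: (forces_mono (A := f_pos one a) vu a0).
split; first exact: (forces_mono (A := f_pos one b) vu b0).
have vq : le v q by apply: le_trans rq; apply: le_trans sr; apply: le_trans ts;
  exact: le_trans ut.
apply/forces_related3; move/forces_related3: ab => ab.
apply: memf_eql (memf_mono vu ab).
apply: eqf_opair (eqf_refl _ _) (eqf_opair (eqf_refl _ _) _).
exact: eqf_sym (eqf_mono vq xy).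
Qed.

Lemma forces_pos n p : p ||- f_pos one (num n) <-> 0 < n.
Proof.
split=> [H|n0 q qp /eqf_num nE]; last by rewrite nE in n0.
by case: n H => // /(_ p (le_refl p) (eqf_refl _ _)).
Qed.

(** Possible summands are members of [S], hence densely equal to numerals, whose membership is
    already decided by [S0]; a decomposition thus exists in the extension exactly when one exists in
    the ground model. *)
Lemma decided_primitive p S (S0 : set nat) :
  decided p (fun x => FMem x S) S0 ->
  p ||- FAllIn S (fun x => FMem x (omega one)) ->
  decided p (f_primitive one S) (primitive S0).
Proof.
move=> Sdec Som; have [S1 _] := Sdec; split=> n.
  move=> [nS n0 nprim]; split; first exact: S1.
  split; first by apply/forces_pos.
  move=> q qp /densely_ex[r rq [a [aS H]]].
  have [s sr [b [bS [a0 [b0 ab]]]]] := densely_ex H.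
  have sp := le_trans (le_trans sr rq) qp.
  have {}aS := memf_mono sr aS.
  have /memf_omega/densely_ex[t ts [a' aE]] := Som a s sp aS.
  have tp := le_trans ts sp.
  have /memf_omega/densely_ex[u ut [b' bE]] := Som b t tp (memf_mono ts bS).
  have us := le_trans ut ts; have up := le_trans us sp.
  have {}aE := eqf_mono ut aE.
  apply: nprim; exists a', b'.
  have mem x x' : memf x S s -> eqf x (num x') u -> S0 x'.
    move=> /(memf_mono us) xS xE; apply: (decided_true Sdec up).
    exact: memf_eql xE xS.
  have pos x x' : s ||- f_pos one x -> eqf x (num x') u -> 0 < x'.
    move=> x0 xE; rewrite lt0n; apply/negP => /eqP E; rewrite E in xE.
    exact: (x0 u us xE).
  split; [split; [exact: mem aE | exact: pos aE] |
          split; [exact: mem bE | exact: pos bE] |].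
  apply/(forces_add _ _ _ u)/forces_related3.
  apply: memf_eql (eqf_opair aE (eqf_opair bE (eqf_refl _ _))) _.
  by apply/forces_related3; apply: forces_mono us _; exact: ab.
move=> nprim q qp [nS [n0 Hn]]; apply: nprim; split.
- exact: decided_true Sdec qp nS.
- by apply/(forces_pos n q).
- move=> [a [b [[aS a0] [bS b0] nab]]].
  pose F x y := FAnd (f_pos one x)
    (FAnd (f_pos one y) (f_related3 x y (num n) (add_graph one))).
  suff : q ||- FExIn S (fun x => FExIn S (F x)) by exact: Hn.
  apply: forces_exin_intro (forces_mono qp (S1 a aS)) _.
  apply: forces_exin_intro (forces_mono qp (S1 b bS)) _.
  split; first exact/forces_pos.
  by split; [exact/forces_pos | exact/forces_add].
Qed.

Lemma forces_wilf13 p :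
  (forall S, numerical_semigroup S -> left_count S = 13 ->
     conductor S <= 13 * embedding_dim S) ->
  p ||- f_wilf13 one.
Proof.
move=> wilf S q qp [[Som [zeroS [addS compl]]] lc].
pose wilf_bound c := FEx (fun e => FEx (fun t =>
  FAnd (f_conductor one S c) (FAnd (f_embedding_dim one S e)
    (FAnd (f_related3 (num 13) e t (mul_graph one)) (f_le c t))))).
suff : q ||- FEx wilf_bound by [].
apply: forces_by compl _ => q1 q1q [k kcard].
have compl_om : subset_omega q1
    (fun x => FAnd (FMem x (omega one)) (FNot (FMem x S))).
  by move=> r x _ [].
have := card_decided (@extensional_notmem S) compl_om kcard.
move/forces_by; apply => q2 q21 [X [Xu _ [XA XnA]]].
have q2q := le_trans q21 q1q.
pose S0 := [set n | n \notin X].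
have Sdec : decided q2 (fun x => FMem x S) S0.
  split=> n; last by move/negP; rewrite negbK => /XA[].
  (* [X] lists the gaps, so it decides non-membership in the complement; membership in [S] itself
     follows by classical logic. *)
  move=> nX; apply: forces_notnot => r rq2 nS.
  have /XnA/(_ r rq2) : ~ [set n | n \in X] n by apply/negP.
  by apply; split; first exact: memf_num_omega.
have S0mem n r : le r q2 -> memf (num n) S r -> S0 n.
  exact: decided_true Sdec.
have memS0 n r : S0 n -> le r q2 -> memf (num n) S r.
  by have [+ _] := Sdec => /[apply] nS r2; exact: memf_mono r2 nS.
have S0sg : numerical_semigroup S0.
  split; first by apply: (S0mem 0 q2) => //; exact: memf_mono zeroS.
    move=> x y xS yS; apply: (S0mem _ q2 (le_refl q2)).
    apply: (addS (num x) q2 q2q (memS0 _ _ xS _) (num y) q2 _ (memS0 _ _ yS _)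
      (num (x + y)) q2) => //.
    exact/forces_add.
  apply: (sub_finite_set (B := [set` X])) (finite_seq X) => n /=.
  by move/negP; rewrite negbK.
apply: forces_by (densely_mono q2q lc) _ => q3 q32 [c [ccond ccard]].
have [com [ctail cmin]] := ccond.
move/memf_omega: com => com; apply: forces_by com _ => q4 q43 [c0 cE].
have q42 := le_trans q43 q32.
have c0E : conductor S0 = c0.
  apply: leastP => [x c0x|d dtail].
    apply: (S0mem x q4) => //.
    refine (ctail (num x) q4 q43 (@memf_num_omega _ q4) q4 (le_refl q4) _).
    by apply: extensional_le_l (eqf_sym cE) _; apply/forces_le.
  (* A tail of [S0] is forced to be a tail of [S], since members of omega are densely numerals; the
     forced minimality of [c] then applies to [d]. *)
  have {}dtail : q4 ||- f_tail one S (num d).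
    move=> x r r4 xom s sr dx; move/memf_omega: xom => xom.
    have H := densely_mono sr xom.
    apply: (@forces_by _ _ (FMem x S) H) => t ts [n xn].
    have {}dx : s ||- f_le (num d) x by exact: dx.
    have /forces_le dn := extensional_le_r xn (forces_mono ts dx).
    apply: memf_eql (eqf_sym xn) _.
    apply: memS0; first exact: dtail.
    by apply: le_trans q42; apply: le_trans r4; exact: le_trans sr.
  have := cmin (num d) q4 q43 (@memf_num_omega _ q4) q4 (le_refl q4) dtail.
  by move/(extensional_le_l cE)/forces_le.
pose B x := FAnd (FMem x S) (FMem x c).
have Bext : extensional B.
  by move=> r x y xy [xS xc]; split; exact: memf_eql xy _.
have Bom : subset_omega q4 B.
  move=> r x r4 [xS _]; apply: Som xS; apply: le_trans r4 _.
  exact: le_trans q42 q2q.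
have {}ccard : q3 ||- f_card one (num 13) B by exact: ccard.
have {}ccond : q3 ||- f_conductor one S c by exact: ccond.
have := card_decided Bext Bom (forces_mono q43 ccard).
move/forces_by; apply => q5 q54 [Y [Yu /eqf_num Y13 YB]].
have q52 := le_trans q54 q42.
have {}cE := eqf_mono q54 cE.
(* [Y] is a ground-model list of length 13 that decides the left elements of [S], so it enumerates
   those of [S0]. *)
have lc13 : left_count S0 = 13.
  rewrite Y13; apply: card_fset_set_seq => // n; rewrite c0E; split.
    move=> [nS /= nc]; apply: (decided_true YB (le_refl q5)); split.
      exact: memS0.
    by apply: memf_eqr (eqf_sym cE) _; apply/memf_num.
  have [YB1 _] := YB => /YB1[nS nc]; split; first exact: S0mem nS.
  by apply/(memf_num n c0 q5); exact: memf_eqr cE nc.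
have := wilf S0 S0sg lc13; rewrite c0E.
set Z : seq nat := fset_set (primitive S0) => c0Z.
have Zu : uniq Z by exact: fset_uniq.
have Zprim : decided q5 (f_primitive one S) [set n | n \in Z].
  have -> : [set n | n \in Z] = primitive S0.
    apply/seteqP; split=> n /=; rewrite /Z in_fset_set ?inE //;
      exact: finite_primitive.
  apply: decided_primitive; first exact: decided_mono q52 Sdec.
  by move=> x r r5; apply: Som; apply: le_trans r5 (le_trans q52 q2q).
(* The witnesses are the given name [c] and the numerals of the embedding dimension of [S0] and of
   13 times it. *)
apply: (forces_ex_intro (x := c)); apply: (forces_ex_intro (x := num (size Z))).
apply: (forces_ex_intro (x := num (13 * size Z))).
split; last split; last split.
- by apply: forces_mono ccond; exact: le_trans q54 q43.
- apply: card_intro => //; first exact: extensional_primitive.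
  move=> r x r5 [xS _]; apply: Som xS.
  exact: le_trans r5 (le_trans q52 q2q).
- exact/forces_mul.
- by apply: extensional_le_l (eqf_sym cE) _; apply/forces_le.
Qed.

(** An element of omega is densely a numeral, so only the ground-model codes [u] need a dense supply
    of stages and cells. *)
Lemma forces_read_all p (f g : name P) :
  (forall u q, le q p -> densely q (fun r => exists n a,
     memf (opair one (num n) a) f r /\
     memf (triple one (num u) (num n) a) g r)) ->
  p ||- FAllIn (omega one) (fun u => FExIn (omega one) (fun n => FEx (fun a =>
    FAnd (f_related n a f) (f_related3 u n a g)))).
Proof.
move=> dense_fg x q qp; move/memf_omega=> xom.
suff : q ||- FExIn (omega one) (fun n => FEx (fun a =>
  FAnd (f_related n a f) (f_related3 x n a g))) by [].
apply: forces_by xom _ => r rq [u xu].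
apply: forces_by (dense_fg u r (le_trans rq qp)) _ => s sr [n [a [fa ga]]].
apply: forces_exin_intro (@memf_num_omega n s) _.
apply: (forces_ex_intro (x := a)); split; first exact/forces_related.
apply/forces_related3; apply: memf_eql ga.
exact: eqf_opair (eqf_sym (eqf_mono sr xu)) (eqf_refl _ _).
Qed.

End Forcing_theory.

(** * Acceptance, genericity and the main theorem *)

Section Acceptance.
Variables (pairing : nat -> nat -> nat) (sched : nat -> nat).
Hypothesis pairing_bij : bijective (fun x : nat * nat => pairing x.1 x.2).
Hypothesis schedE : forall u t, sched (pairing u t) = u.
Variables (producer verifier : prog).
Hypothesis certified : certification producer verifier.
Hypothesis R13_holds : forall u, R13 u.

Let C := accepted producer verifier sched.
Let X := X_acc producer verifier sched.

(** By pigeonhole, the [b.+1] distinct stages [pairing u t] with [t <= b] cannot all lie below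
    [b]. *)
Lemma sched_cofinal u b : exists2 n, b <= n & sched n = u.
Proof.
have inj t t' : pairing u t = pairing u t' -> t = t'.
  by move/(bij_inj pairing_bij (x1 := (u, t)) (x2 := (u, t'))) => [].
have [|small] := pselect (exists t, b <= pairing u t).
  by move=> [t bt]; exists (pairing u t).
have lt_b (t : 'I_b.+1) : pairing u t < b.
  by rewrite ltnNge; apply/negP => bt; apply: small; exists t.
have : injective (fun t => Ordinal (lt_b t)).
  by move=> t t' [/inj/val_inj].
by move/leq_card; rewrite !card_ord ltnn.
Qed.

Lemma accepting_bound u :
  exists N, forall n, sched n = u -> quadrant N `<=` C n.
Proof.
have halting (p : bool) : exists N, exists2 z,
    halts_within N producer [:: u; nat_of_bool p] z &
    halts_within N verifier [:: u; nat_of_bool p; z] 1.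
  have [z [s rs] [t rt]] := certification_complete certified p (R13_holds u).
  exists (maxn s t), z; [exists s => // | exists t => //];
    by rewrite ?leq_maxl ?leq_maxr.
have [N0 H0] := halting false; have [N1 H1] := halting true.
exists (maxn N0 N1) => n nu a []; rewrite !geq_max.
move=> /andP[a0 a1] /andP[b0 b1].
have mono k l p xs z : k <= l -> halts_within k p xs z -> halts_within l p xs z.
  by move=> kl [t tk r]; exists t => //; exact: leq_trans kl.
rewrite /C /accepted /reads /= nu.
(* A quadrant has cells of both parities, which is why its index dominates the running times of both
   requests. *)
by case: (parity a); [have [z pz vz] := H1 | have [z pz vz] := H0];
  exists z; split; (apply: mono pz || apply: mono vz).
Qed.

(* Tying stage [n] to the quadrant of index [n] avoids computing any running
   time: the bound for [u] is passed by almost all of the stages of [u]. *)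
Lemma X_acc_eventually g b :
  (forall n, b <= n -> quadrant n (g n)) -> X g.
Proof.
move=> gq u _; have [N NC] := accepting_bound u.
have [n nb nu] := sched_cofinal u (maxn b N); exists n => //=.
move: nb; rewrite geq_max => /andP[bn Nn].
by apply: (NC n nu); have [g1 g2] := gq n bn; split; exact: leq_trans Nn _.
Qed.

Lemma accepted_refinement (T : condition) : exists T' : condition,
  [/\ stronger T' T, stem T' = stem T &
      forall g, body (nodes T') g -> forall n, size (stem T) <= n -> C n (g n)].
Proof.
apply: restrict_stages => n; have [N] := accepting_bound (sched n).
by move/(_ n erefl); exists N.
Qed.

Lemma dense_body_X : dense [set T | body (nodes T) `<=` X].
Proof.
move=> T; have [T' [T'T _ T'C]] := accepted_refinement T.
exists T' => // g /T'C gC u _.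
by have [n /gC] := sched_cofinal u (size (stem T)); exists n.
Qed.

Lemma computable_tree : exists T : condition,
  [/\ pure_quadrant T, computable (fun t : seq cell => `[< nodes T t >]) &
      body (nodes T) `<=` X].
Proof.
pose A := [set t | in_stage_quadrants t].
have Acl u v : prefix u v -> A v -> A u.
  move=> /prefixP[w ->] Av k ku; have := Av k.
  by rewrite size_cat nth_cat ku; apply; exact: leq_trans (leq_addr _ _).
have Arcons t : A t -> [set a | A (rcons t a)] = quadrant (size t).
  move=> At; apply/seteqP; split=> a.
    move=> /(_ (size t)); rewrite size_rcons nth_rcons ltnn eqxx.
    exact.
  move=> ta k; rewrite size_rcons ltnS nth_rcons.
  by case: ltngtP => // [kt|->] _ //; exact: At.
have Acmp t : A t -> prefix t [::] || prefix [::] t by rewrite prefix0s orbT.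
have Alarge t : A t -> prefix [::] t ->
    exists N, quadrant N `<=` [set a | A (rcons t a)].
  by move=> At _; exists (size t); rewrite Arcons.
have A0 : A [::] by [].
exists (quadrant_tree Acl A0 Acmp Alarge).
split; first by move=> t At _; exists (size t); exact: Arcons.
  exact: computable_in_stage_quadrants.
move=> g gA; apply: (@X_acc_eventually g 0) => n _.
by have := gA n.+1 n; rewrite size_mkseq nth_mkseq //; apply.
Qed.

Lemma computable_strategy s : exists f : strategy,
  computable (fun x : seq (nat * cell) * nat => f x.1 x.2) /\ winning s X f.
Proof.
(* The code of [(h, N)] bounds both [N] and the number of rounds in [h]. *)
exists (fun h N => (pickle (h, N), pickle (h, N))); split.
  have [p pP] := computable_diagonal; exists p => -[h N]; exact: pP.
move=> N a aE; have bound r : r <= (a r).1 /\ N r <= (a r).1.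
  rewrite aE /=; set h := mkseq _ r.
  have := CodeSeq.ltn_code [:: pickle h; N r] => /and3P[hx Nx _].
  split; last exact: ltnW.
  apply: leq_trans (ltnW hx); rewrite -[r](size_mkseq (fun k => (N k, a k))).
  by rewrite -(size_map pickle) size_le_code.
have diag r : (a r).2 = (a r).1 by rewrite aE.
split=> [r|]; first by have [] := bound r; split; rewrite ?diag.
move=> u _; have [M MC] := accepting_bound u.
have [n nb nu] := sched_cofinal u (size s + M); exists n => //=.
(* Stage [n] is round [n - size s], which is at least [M] by the choice of [n]; the answer in a
   round is at least the round number. *)
apply: (MC n nu); rewrite /prepend ltnNge (leq_trans (leq_addr _ _) nb) /=.
have [r_a _] := bound (n - size s).
have Mn : M <= (a (n - size s)).1.
  by apply: leq_trans r_a; rewrite leq_subRL // (leq_trans (leq_addr _ _) nb).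
by split; rewrite ?diag.
Qed.

(** For density, the stem is first lengthened to end just before a later stage of [u], and then by
    one cell from the accepting quadrant. Openness holds because stems only grow. *)
Lemma open_dense_decides u :
  open_dense (decides_code producer verifier sched u).
Proof.
split=> [T|T T' [n [nT nu Cn]] T'T]; last first.
  have /prefixP[w wE] := stronger_stem T'T.
  by exists n; rewrite wE size_cat nth_cat nT (leq_trans nT) ?leq_addr.
have [n Tn nu] := sched_cofinal u (size (stem T)).
have [T1 T1T T1n] := stem_longer Tn.
have [N /(_ n nu) NC] := accepting_bound u.
have [a /NC Ca Ta] := nodes_extend N (nodes_stem T1) (prefix_refl _).
have [T2 T2T1 E] := extend_stem Ta (prefix_rcons _ _).
exists T2; first exact: stronger_trans T1T.
by exists n; rewrite E size_rcons nth_rcons T1n ltnn eqxx.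
Qed.

Lemma forces_reads_all :
  forces stronger full_condition (f_reads_all producer verifier sched).
Proof.
rewrite /f_reads_all.
refine (forces_read_all stronger_refl stronger_trans stronger_full _).
move=> u T _ T1 T1T.
have [T2 T2T1 [n [nT nu [z zr]]]] := (open_dense_decides u).1 T1.
exists T2 => //; set a := nth _ _ _ in zr.
(* The number [z] read by the cell is an output of the producer, whose specification makes it the
   code of a requested certificate. *)
have [d dreq zE] : exists2 d, requested u (parity a) d & z = pickle d.
  apply: (producer_requested certified); have [[t _ run] _] := zr.
  by exists t; rewrite -nu.
have sound : sound_reading producer verifier sched u n a.
  by split=> //; exists d; split=> //; rewrite -nu -zE.
exists n, (cell_name a); split.
  (* In the name of the generic branch the pair of [n] and [a] carries the condition [T2], whose
     stem contains that cell, so [T2] forces it into the branch. *)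
  exact: (memf_intro stronger_refl stronger_trans _
    (j := Tagged (fun T => 'I_(size (stem T))) (Ordinal nT))).
exact: (memf_ground_intro stronger_refl stronger_trans stronger_full _
  (exist _ (u, n, a) sound)).
Qed.

End Acceptance.

Theorem theorem14p2
    (pairing : nat -> nat -> nat)
    (pairing_bij : bijective (fun x : nat * nat => pairing x.1 x.2))
    (pairing_computable : computable (fun x : nat * nat => pairing x.1 x.2))
    (sched : nat -> nat)
    (schedE : forall u t, sched (pairing u t) = u)
    (producer verifier : prog)
    (certified : certification producer verifier)
    (implications : forall S : set nat,
       numerical_semigroup S -> left_count S = 13 ->
       [/\ (embedding_dim S <= 3 -> conductor S <= 13 * embedding_dim S),
           (depth S <= 3 -> conductor S <= 13 * embedding_dim S),
           (4 <= embedding_dim S -> depth S = 4 ->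
              conductor S <= 13 * embedding_dim S) &
           (4 <= embedding_dim S -> 5 <= depth S ->
              conductor S <= 13 * embedding_dim S)]) :
  let C := accepted producer verifier sched in
  let X := X_acc producer verifier sched in
  let D := decides_code producer verifier sched in
  (* (a) *)
  ((forall T : condition, exists T' : condition,
      [/\ stronger T' T, stem T' = stem T &
          forall g, body (nodes T') g ->
            forall n, size (stem T) <= n -> C n (g n)]) /\
   dense [set T | body (nodes T) `<=` X]) /\
  (* (b) *)
  ((exists T : condition,
      [/\ pure_quadrant T,
          computable (fun t : seq cell => `[< nodes T t >]) &
          body (nodes T) `<=` X]) /\
   (forall s : seq cell, exists f : strategy,
      computable (fun x : seq (nat * cell) * nat => f x.1 x.2) /\
      winning s X f)) /\
  (* (c) *)
  ((forall u, open_dense (D u)) /\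
   forces stronger full_condition (f_reads_all producer verifier sched) /\
   forces stronger full_condition (f_wilf13 full_condition)).
Proof.
move=> C X D.
have wilf S : numerical_semigroup S -> left_count S = 13 ->
    conductor S <= 13 * embedding_dim S.
  move=> Ssg lc; have [e3 q3 q4 q5] := implications S Ssg lc.
  (* The split is exhaustive: either the embedding dimension is at most 3, or the depth is below,
     above or equal to 4. *)
  have [/e3 //|e4] := leqP (embedding_dim S) 3.
  by case: (ltngtP (depth S) 4) => [/q3|/(q5 e4)|/(q4 e4)].
have R13_holds := R13_of_wilf wilf.
split; [split|split; [split|split; [|split]]].
- exact: accepted_refinement.
- exact: (dense_body_X pairing_bij).
- exact: (computable_tree pairing_bij).
- exact: (computable_strategy pairing_bij).
- exact: (open_dense_decides pairing_bij).
- exact: (forces_reads_all pairing_bij).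
- exact: (forces_wilf13 stronger_refl stronger_trans stronger_full).
Qed.
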